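(* Let $\Delta$ be a countably infinite structure with a finite relational signature which is ordered, homogeneous, Ramsey, and finitely bounded. Then for every reduct $\Gamma$ of $\Delta$ with finite relational signature, the computational problems $\operatorname{Expr}_{\operatorname{ex}}(\Gamma)$ and $\operatorname{Expr}_{\operatorname{ep}}(\Gamma)$ are decidable.
   Context: Substructures are always induced. Let $\tau$ be a finite relational signature. The age of a $\tau$-structure is the class of all finite $\tau$-structures that embed into it. A class $\mathcal C$ of finite $\tau$-structures, and likewise a structure with age $\mathcal C$, is called: - finitely bounded iff there is a finite set $\mathcal F$ of finite $\tau$-structures such that for every finite $\tau$-structure $A$: $A\in\mathcal C$ iff no structure from $\mathcal F$ embeds into $A$; - Ramsey iff for all $k\ge 1$ and all $H,P\in\mathcal C$ there is $S\in\mathcal C$ such that for every coloring with $k$ colors of the copies of $P$ in $S$ (i.e. substructures of $S$ isomorphic to $P$) there is a copy of $H$ in $S$ all of whose copies of $P$ have the same color; - ordered iff $\tau$ contains a binary relation symbol that denotes a total order in every $A\in\mathcal C$. A structure is homogeneous iff every isomorphism between finite induced substructures extends to an automorphism of the whole structure. A structure $\Gamma$ is a reduct of a structure $\Delta$ with the same domain iff all relations of $\Gamma$ are first-order definable (without parameters) in $\Delta$. A first-order formula is existential iff it is of the form $\exists y_1\ldots\exists y_m.\,\psi$ with $\psi$ quantifier-free (equality allowed). It is existential positive iff it is existential and contains no negations. For a fixed structure $\Gamma$ with finite relational signature $\sigma$, the problem $\operatorname{Expr}_{\operatorname{ex}}(\Gamma)$ (respectively $\operatorname{Expr}_{\operatorname{ep}}(\Gamma)$)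 is the following. Input: quantifier-free $\sigma$-formulas $\phi_0,\phi_1,\dots,\phi_n$ (equality allowed), each with a given list of free variables, defining relations $R_0,R_1,\dots,R_n$ over the domain $D$ of $\Gamma$. Question: is there an existential (respectively existential positive) formula over a signature consisting of symbols for $R_1,\dots,R_n$ which defines $R_0$ in the structure $(D;R_1,\dots,R_n)$? Decidable means that there is an algorithm (for the fixed $\Gamma$) that answers the question correctly on every input. *)

(* Defs.v *)
From mathcomp Require Import all_boot.
From mathcomp Require Import boolp classical_sets functions cardinality.

Set Implicit Arguments.
Unset Strict Implicit.
Unset Printing Implicit Defensive.

Local Open Scope classical_set_scope.

(** * Relational structures *)

Record signature := Signature { sym :> finType; ar : sym -> nat }.

Definition structure (tau : signature) (T : Type) :=
  forall s : tau, (ar s).-tuple T -> Prop.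

Definition preserves_rels (tau : signature) (T U : Type)
    (M : structure tau T) (N : structure tau U) (f : T -> U) :=
  forall (s : tau) (t : (ar s).-tuple T), M s t <-> N s (map_tuple f t).

Definition embedding (tau : signature) (T U : Type)
    (M : structure tau T) (N : structure tau U) (f : T -> U) :=
  injective f /\ preserves_rels M N f.

Definition isomorphism (tau : signature) (T U : Type)
    (M : structure tau T) (N : structure tau U) (f : T -> U) :=
  bijective f /\ preserves_rels M N f.

Definition induced (tau : signature) (T : Type) (M : structure tau T)
    (X : set T) : structure tau X :=
  fun s t => M s (map_tuple val t).

(* Finite structures may be empty. *)
Record fin_structure (tau : signature) :=
  FinStructure { carrier :> finType; rels : structure tau carrier }.

Definition embeds (tau : signature) (A : fin_structure tau)
    (T : Type) (M : structure tau T) :=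
  exists f : A -> T, embedding (@rels _ A) M f.

Definition age (tau : signature) (T : Type) (M : structure tau T) :
    fin_structure tau -> Prop :=
  fun A => embeds A M.

(** * Properties of classes of finite structures *)

Definition finitely_bounded (tau : signature) (C : fin_structure tau -> Prop) :=
  exists (m : nat) (F : 'I_m -> fin_structure tau),
    forall A : fin_structure tau,
      C A <-> forall i : 'I_m, ~ embeds (F i) (@rels _ A).

(* [X] is the domain of a copy of [P] in [S]. *)
Definition is_copy (tau : signature) (P S : fin_structure tau) (X : set S) :=
  exists f : P -> X, isomorphism (@rels _ P) (induced (@rels _ S) (X := X)) f.

(* Coloring all subsets rather than just the copies of [P] makes no           *)
(* difference, since only the colors of copies of [P] are constrained.        *)
Definition ramsey (tau : signature) (C : fin_structure tau -> Prop) :=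
  forall (k : nat) (H P : fin_structure tau), 0 < k -> C H -> C P ->
  exists S : fin_structure tau, C S /\
    forall chi : set S -> 'I_k,
    exists X : set S, is_copy H X /\
      forall Y Z : set S, Y `<=` X -> Z `<=` X ->
        is_copy P Y -> is_copy P Z -> chi Y = chi Z.

Definition strict_total_order (T : Type) (R : T -> T -> Prop) :=
  [/\ forall x, ~ R x x,
      forall x y z, R x y -> R y z -> R x z
    & forall x y, R x y \/ x = y \/ R y x].

Definition reflexive_total_order (T : Type) (R : T -> T -> Prop) :=
  [/\ forall x y, R x y -> R y x -> x = y,
      forall x y z, R x y -> R y z -> R x z
    & forall x y, R x y \/ R y x].

(* The order symbol may be interpreted as [<], as in (Q; <), or as [<=]. *)
Definition total_order (T : Type) (R : T -> T -> Prop) :=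
  strict_total_order R \/ reflexive_total_order R.

Definition ordered (tau : signature) (C : fin_structure tau -> Prop) :=
  exists (s : tau) (ar2 : ar s = 2), forall A : fin_structure tau, C A ->
    total_order (fun x y : A => rels (tcast (esym ar2) [tuple x; y])).

(** * Homogeneity *)

Definition homogeneous (tau : signature) (T : Type) (M : structure tau T) :=
  forall (X Y : set T) (f : X -> Y), finite_set X -> finite_set Y ->
    isomorphism (induced M (X := X)) (induced M (X := Y)) f ->
    exists a : T -> T, isomorphism M M a /\
      forall x : X, a (val x) = val (f x).

(** * First-order formulas *)

(* [formula sg n] is the type of formulas with free variables among           *)
(* x_0, ..., x_(n-1).  Binding is de Bruijn style: under a quantifier the     *)
(* bound variable is x_0, and each variable x_i of the context becomes        *)
(* x_(i+1).                                                                   *)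
Inductive formula (sg : signature) : nat -> Type :=
| FFalse n : formula sg n
| FEq n (i j : 'I_n) : formula sg n
| FRel n (s : sg) (v : (ar s).-tuple 'I_n) : formula sg n
| FNot n (p : formula sg n) : formula sg n
| FAnd n (p q : formula sg n) : formula sg n
| FOr n (p q : formula sg n) : formula sg n
| FEx n (p : formula sg n.+1) : formula sg n
| FAll n (p : formula sg n.+1) : formula sg n.

(* [sat M p] is the [n]-ary relation defined by [p] in [M]. *)
Fixpoint sat (sg : signature) (T : Type) (M : structure sg T) (n : nat)
    (p : formula sg n) : n.-tuple T -> Prop :=
  match p in formula _ n return n.-tuple T -> Prop with
  | FFalse _ => fun _ => False
  | FEq _ i j => fun e => tnth e i = tnth e j
  | FRel _ s v => fun e => M s (map_tuple (tnth e) v)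
  | FNot _ p => fun e => ~ sat M p e
  | FAnd _ p q => fun e => sat M p e /\ sat M q e
  | FOr _ p q => fun e => sat M p e \/ sat M q e
  | FEx _ p => fun e => exists x : T, sat M p [tuple of x :: e]
  | FAll _ p => fun e => forall x : T, sat M p [tuple of x :: e]
  end.

Definition defines (sg : signature) (T : Type) (M : structure sg T) (n : nat)
    (p : formula sg n) (R : n.-tuple T -> Prop) :=
  forall t : n.-tuple T, R t <-> sat M p t.

Fixpoint quantifier_free (sg : signature) (n : nat) (p : formula sg n) : bool :=
  match p with
  | FFalse _ | FEq _ _ _ | FRel _ _ _ => true
  | FNot _ p => quantifier_free p
  | FAnd _ p q | FOr _ p q => quantifier_free p && quantifier_free q
  | FEx _ _ | FAll _ _ => false
  end.

Fixpoint existential (sg : signature) (n : nat) (p : formula sg n) : bool :=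
  if p is FEx _ q then existential q else quantifier_free p.

Fixpoint negation_free (sg : signature) (n : nat) (p : formula sg n) : bool :=
  match p with
  | FFalse _ | FEq _ _ _ | FRel _ _ _ => true
  | FNot _ _ => false
  | FAnd _ p q | FOr _ p q => negation_free p && negation_free q
  | FEx _ p | FAll _ p => negation_free p
  end.

Definition existential_positive (sg : signature) (n : nat) (p : formula sg n) :=
  existential p && negation_free p.

Definition reduct (tau sigma : signature) (D : Type)
    (Gamma : structure sigma D) (Delta : structure tau D) :=
  forall s : sigma, exists p : formula tau (ar s), defines Delta p (@Gamma s).

(** * The problems Expr_ex and Expr_ep *)

(* A quantifier-free formula together with the number of its listed free      *)
(* variables, the list being x_0, ..., x_(qf_arity - 1).                      *)
Record qf_formula (sigma : signature) := QFFormula {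
  qf_arity : nat;
  qf_form :> formula sigma qf_arity;
  qf_formP : quantifier_free qf_form }.

(* [target] is phi_0 and [sources] is the list phi_1, ..., phi_n. *)
Record expr_input (sigma : signature) := ExprInput {
  target : qf_formula sigma;
  sources : seq (qf_formula sigma) }.

Definition source (sigma : signature) (x : expr_input sigma)
    (i : 'I_(size (sources x))) : qf_formula sigma :=
  tnth (in_tuple (sources x)) i.

Definition source_signature (sigma : signature) (x : expr_input sigma) :=
  @Signature 'I_(size (sources x)) (fun i => qf_arity (source i)).

(* The structure (D; R_1, ..., R_n). *)
Definition source_structure (sigma : signature) (D : Type)
    (Gamma : structure sigma D) (x : expr_input sigma) :
    structure (source_signature x) D :=
  fun i t => sat Gamma (source i) t.

Definition Expr_ex (sigma : signature) (D : Type) (Gamma : structure sigma D)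
    (x : expr_input sigma) : Prop :=
  exists p : formula (source_signature x) (qf_arity (target x)),
    existential p /\
    defines (source_structure Gamma (x := x)) p (sat Gamma (target x)).

Definition Expr_ep (sigma : signature) (D : Type) (Gamma : structure sigma D)
    (x : expr_input sigma) : Prop :=
  exists p : formula (source_signature x) (qf_arity (target x)),
    existential_positive p /\
    defines (source_structure Gamma (x := x)) p (sat Gamma (target x)).

(** * Computability *)

(* The total recursive functions on the natural numbers: the least class of   *)
(* total functions containing the initial functions and closed under          *)
(* composition, primitive recursion and minimization of regular functions.    *)
(* By Kleene's normal form theorem these are exactly the total functions      *)
(* computed by Turing machines.                                               *)
Inductive total_recursive : forall n : nat, (n.-tuple nat -> nat) -> Prop :=
| rec_zero n : total_recursive (fun _ : n.-tuple nat => 0)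
| rec_succ : total_recursive (fun v : 1.-tuple nat => (thead v).+1)
| rec_proj n (i : 'I_n) : total_recursive (fun v : n.-tuple nat => tnth v i)
| rec_comp n m (g : m.-tuple nat -> nat) (h : 'I_m -> n.-tuple nat -> nat) :
    total_recursive g -> (forall i, total_recursive (h i)) ->
    total_recursive (fun v : n.-tuple nat => g [tuple h i v | i < m])
| rec_prim n (g : n.-tuple nat -> nat) (h : n.+2.-tuple nat -> nat)
    (f : n.+1.-tuple nat -> nat) :
    total_recursive g -> total_recursive h ->
    (forall v : n.-tuple nat, f [tuple of 0 :: v] = g v) ->
    (forall (k : nat) (v : n.-tuple nat),
       f [tuple of k.+1 :: v] =
       h [tuple of k :: f [tuple of k :: v] :: v]) ->
    total_recursive f
| rec_mu n (g : n.+1.-tuple nat -> nat) (f : n.-tuple nat -> nat) :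
    total_recursive g ->
    (forall v : n.-tuple nat, g [tuple of f v :: v] = 0) ->
    (forall (v : n.-tuple nat) (k : nat), k < f v ->
       g [tuple of k :: v] <> 0) ->
    total_recursive f.

(* Goedel numbers, built on the bijection CodeSeq.code : seq nat -> nat. *)
Fixpoint formula_code (sg : signature) (n : nat) (p : formula sg n) : nat :=
  match p with
  | FFalse _ => CodeSeq.code [:: 0]
  | FEq _ i j => CodeSeq.code [:: 1; val i; val j]
  | FRel _ s v =>
      CodeSeq.code [:: 2, val (enum_rank s) & [seq val i | i <- v]]
  | FNot _ p => CodeSeq.code [:: 3; formula_code p]
  | FAnd _ p q => CodeSeq.code [:: 4; formula_code p; formula_code q]
  | FOr _ p q => CodeSeq.code [:: 5; formula_code p; formula_code q]
  | FEx _ p => CodeSeq.code [:: 6; formula_code p]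
  | FAll _ p => CodeSeq.code [:: 7; formula_code p]
  end.

Definition qf_formula_code (sigma : signature) (p : qf_formula sigma) : nat :=
  CodeSeq.code [:: qf_arity p; formula_code p].

Definition expr_input_code (sigma : signature) (x : expr_input sigma) : nat :=
  CodeSeq.code [seq qf_formula_code p | p <- target x :: sources x].

(* The answer is 1 for yes and 0 for no. *)
Definition decidable_problem (I : Type) (code : I -> nat) (P : I -> Prop) :=
  exists2 f : 1.-tuple nat -> nat, total_recursive f &
    forall x : I, f [tuple code x] = `[< P x >] :> nat.

(* Main.v *)
Require Import Defs.
From mathcomp Require Import all_boot.
From mathcomp Require Import boolp classical_sets functions cardinality.
From mathcomp Require Import zify.

(** The relation defined by the target fails to be existential positive
definable from the sources exactly when some tuple [t] inside it and some tuple
[s] outside it are such that, for every finite set of points, a partial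
homomorphism between the source relations is defined on that set and sends [t]
to [s].  Indeed such maps transport the witnesses of an existential positive
formula; and if for all [t] and [s] some finite set admits no such map, then,
up to automorphisms, finitely many of these sets suffice, and their positive
diagrams yield a defining formula ([definable_not_separated],
[not_separated_definable]).  Existential formulas are treated in the same way
after adding the complements of equality and of the sources.

This criterion quantifies over all finite sets of points.  The Ramsey property
replaces it by a finite one.  Colour a tuple that starts with the parameters [t]
by the type of its image under a partial homomorphism.  On a suitable copy of
any given finite set the colour depends on the type of the tuple alone, and so
the map induces a function [B] from types to types, its behaviour
([separated_certificate]).  The Ramsey property is given without parameters; it
passes to parameters by moving all copies of [t] back to [t] with automorphisms
([ramsey_constants]), and it concerns sets instead of tuples, which is
harmless because the order makes finite structures rigid ([same_type_rigid]).

Conversely, a function [B] on types of bounded length that commutes with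
reindexing, fixes the type of the parameters and preserves the source relations
is enough: applied to the subtuples of a finite set it prescribes a finite
structure, and by finite boundedness this structure embeds into [D]
([realization], [certificate_separated]).

All of this takes place on finite data.  For a fixed large [b] the orbits of
[b]-tuples are finitely many colours, every longer type is a table of colours
of its [b]-subtuples, and the tables that occur are those compatible with the
finite table describing the effect of reindexing on colours.  The relations of
[Gamma] are unions of orbits, so they are sets of colours, and quantifier-free
formulas can be evaluated at a type.  Hence a search through all functions
between two finite lists of types decides the problem ([separatedbP]).  The
search is a functional program on lists of numbers, and its recursiveness
follows from closure properties of the functions that are recursive on codes
([computable_separatedb]). *)

Set Implicit Arguments.
Unset Strict Implicit.
Unset Printing Implicit Defensive.

(** * Recursive functions of numbers *)

Definition rec1 (f : nat -> nat) :=
  total_recursive (fun v : 1.-tuple nat => f (tnth v ord0)).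

Definition rec2 (f : nat -> nat -> nat) :=
  total_recursive (fun v : 2.-tuple nat => f (tnth v ord0) (tnth v (inord 1))).

Definition rec3 (f : nat -> nat -> nat -> nat) :=
  total_recursive (fun v : 3.-tuple nat =>
    f (tnth v ord0) (tnth v (inord 1)) (tnth v (inord 2))).

Lemma total_recursive_ext n (f g : n.-tuple nat -> nat) :
  f =1 g -> total_recursive f -> total_recursive g.
Proof. by move=> /funext ->. Qed.

Lemma rec1_ext f g : f =1 g -> rec1 f -> rec1 g.
Proof. by move=> /funext ->. Qed.

Section Composition.
Variable n : nat.
Implicit Types g : n.-tuple nat -> nat.

Lemma comp_rec1 f g : rec1 f -> total_recursive g ->
  total_recursive (fun v => f (g v)).
Proof.
move=> rf rg; have := rec_comp rf (h := fun=> g) (fun=> rg).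
by apply: total_recursive_ext => v; rewrite tnth_mktuple.
Qed.

Lemma comp_rec2 f g1 g2 : rec2 f -> total_recursive g1 -> total_recursive g2 ->
  total_recursive (fun v => f (g1 v) (g2 v)).
Proof.
move=> rf r1 r2.
have := rec_comp rf (h := fun i : 'I_2 => nth g1 [:: g1; g2] i) _.
move=> H; have {}H := H (fun i => _).
apply: total_recursive_ext (H _) => [v|[[|[|//]] ?]//].
by rewrite !tnth_mktuple /= inordK.
Qed.

Lemma const_rec c : total_recursive (fun _ : n.-tuple nat => c).
Proof.
elim: c => [|c IH]; first exact: rec_zero.
apply: total_recursive_ext (comp_rec1 (f := succn) _ IH) => //.
exact: rec_succ.
Qed.

End Composition.

Lemma rec1_id : rec1 id. Proof. exact: rec_proj. Qed.

Lemma rec1S : rec1 succn. Proof. exact: rec_succ. Qed.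

(** One parameter is enough: further data can be packed into it by [ncons]. *)
Lemma rec2_prim z h : rec1 z -> rec3 h ->
  rec2 (fun n c => nat_rect (fun=> nat) (z c) (fun k y => h k y c) n).
Proof.
move=> rz rh; apply: rec_prim rz rh _ _ => [v|k v].
  by rewrite (tnth_nth 0) /= inordK //= (tnth_nth 0 v).
rewrite !(tnth_nth 0) /= !inordK //=.
Qed.

Lemma rec2_comp1 f g : rec1 f -> rec2 g -> rec2 (fun x y => f (g x y)).
Proof. exact: comp_rec1. Qed.

Lemma rec2_comp2 f g1 g2 : rec2 f -> rec2 g1 -> rec2 g2 ->
  rec2 (fun x y => f (g1 x y) (g2 x y)).
Proof. exact: comp_rec2. Qed.

Lemma rec1_comp1 f g : rec1 f -> rec1 g -> rec1 (fun x => f (g x)).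
Proof. exact: comp_rec1. Qed.

Lemma rec1_comp2 f g1 g2 : rec2 f -> rec1 g1 -> rec1 g2 ->
  rec1 (fun x => f (g1 x) (g2 x)).
Proof. exact: comp_rec2. Qed.

Lemma rec2_fst : rec2 (fun x _ => x). Proof. exact: rec_proj. Qed.
Lemma rec2_snd : rec2 (fun _ y => y). Proof. exact: rec_proj. Qed.
Lemma rec2_const c : rec2 (fun _ _ => c). Proof. exact: const_rec. Qed.
Lemma rec1_const c : rec1 (fun _ => c). Proof. exact: const_rec. Qed.

Lemma rec2_ext f g : f =2 g -> rec2 f -> rec2 g.
Proof. by move=> fg; have -> : f = g by do 2!apply: funext => ?. Qed.

Lemma rec2_iter h : rec1 h -> rec2 (fun n c => iter n h c).
Proof.
move=> rh.
have H : rec3 (fun _ y _ => h y) by apply: (comp_rec1 rh); apply: rec_proj.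
by apply: rec2_ext (rec2_prim rec1_id H) => n c; elim: n => //= n ->.
Qed.

Lemma rec2_add : rec2 addn.
Proof. by apply: rec2_ext (rec2_iter rec1S) => n c; rewrite iter_succn addnC. Qed.

Lemma rec1_pred : rec1 predn.
Proof.
have H : rec3 (fun k _ _ => k) by apply: rec_proj.
have := rec1_comp2 (rec2_prim (rec1_const 0) H) rec1_id (rec1_const 0).
by apply: rec1_ext; case.
Qed.

Lemma rec2_swap f : rec2 f -> rec2 (fun x y => f y x).
Proof. by move=> rf; exact: rec2_comp2 rf rec2_snd rec2_fst. Qed.

Lemma rec2_sub : rec2 subn.
Proof.
apply: rec2_ext (rec2_swap (rec2_iter rec1_pred)) => n c.
by rewrite iter_predn.
Qed.

Lemma rec2_mul : rec2 muln.
Proof.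
have H : rec3 (fun _ y c => c + y).
  by apply: (comp_rec2 rec2_add); apply: rec_proj.
by apply: rec2_ext (rec2_prim (rec1_const 0) H) => n c; elim: n => //= n ->;
  rewrite mulSn.
Qed.

Lemma rec1_half : rec1 half.
Proof.
have H : rec3 (fun k y _ => k - y) by apply: (comp_rec2 rec2_sub); apply: rec_proj.
have := rec1_comp2 (rec2_prim (rec1_const 0) H) rec1_id (rec1_const 0).
(* [n.+1./2 = n - n./2] *)
by apply: rec1_ext; elim=> //= n ->; lia.
Qed.

Lemma rec1_odd : rec1 odd.
Proof.
have := rec1_comp2 rec2_sub rec1_id (rec1_comp2 rec2_add rec1_half rec1_half).
by apply: rec1_ext => n; lia.
Qed.

Lemma rec2_if f g h : rec2 f -> rec2 g -> rec2 h ->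
  rec2 (fun x y => if f x y != 0 then g x y else h x y).
Proof.
move=> rf rg rh.
pose sg := fun x => 1 - (1 - x).
have rneg : rec1 (fun x => 1 - x) by apply: rec1_comp2 rec2_sub (rec1_const _)
  rec1_id.
have rsg : rec1 sg by exact: (rec1_comp1 rneg rneg).
have := rec2_comp2 rec2_add (rec2_comp2 rec2_mul (rec2_comp1 rsg rf) rg)
  (rec2_comp2 rec2_mul (rec2_comp1 rneg rf) rh).
apply: rec2_ext => x y; rewrite /sg; case: (f x y) => [|n] /=; first by rewrite mul1n.
by rewrite subSS sub0n mul1n mul0n addn0.
Qed.

Lemma rec1_if f g h : rec1 f -> rec1 g -> rec1 h ->
  rec1 (fun x => if f x != 0 then g x else h x).
Proof.
move=> rf rg rh; have rc e : rec1 e -> rec2 (fun x _ => e x).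
  by move=> re; exact: rec2_comp1 re rec2_fst.
exact: rec1_comp2 (rec2_if (rc _ rf) (rc _ rg) (rc _ rh)) rec1_id rec1_id.
Qed.

(** The pairing that CodeSeq.code iterates, so that pairs, lists and the
Goedel numbers of formulas all share one encoding. *)
Definition ncons n m := 2 ^ n * m.*2.+1.

Lemma rec2_ncons : rec2 ncons.
Proof.
have r2 : rec1 double.
  by apply: rec1_ext (rec1_comp2 rec2_add rec1_id rec1_id) => x; lia.
have := rec2_comp2 (rec2_iter r2) rec2_fst (rec2_comp1 rec1S (rec2_comp1 r2
  rec2_snd)).
apply: rec2_ext => n m; rewrite /ncons; elim: n => [|n IH]; first by rewrite mul1n.
by rewrite iterS IH expnS -mulnA mul2n.
Qed.

Lemma half_ncons n m : iter n half (ncons n m) = m.*2.+1.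
Proof.
rewrite /ncons; elim: n => [|n IH]; first by rewrite mul1n.
by rewrite iterSr expnS -mulnA mul2n doubleK.
Qed.

Lemma iter_half0 n : iter n half 0 = 0.
Proof. by elim: n => //= n ->. Qed.

(** The first disjunct keeps the search for the exponent of 2 total at 0. *)
Lemma nhd_exists x : exists n, (x == 0) || odd (iter n half x).
Proof.
case: x => [|x]; first by exists 0.
have <- := CodeSeq.decodeK x.+1.
case: (CodeSeq.decode _) => [|n s]; first by exists 0.
by exists n; rewrite /= -/(ncons n _) half_ncons /= odd_double ?orbT.
Qed.

Definition nhd x := ex_minn (nhd_exists x).
Definition ntl x := half (iter (nhd x) half x).

Lemma nhdK n m : nhd (ncons n m) = n.
Proof.
rewrite /nhd; case: ex_minnP => k;
  rewrite /ncons -muln2 !muln_eq0 expn_eq0 /= => ko kmin.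
apply/eqP; rewrite eqn_leq; apply/andP; split.
  by apply: kmin; rewrite muln2 -/(ncons n m) half_ncons /= odd_double ?orbT.
rewrite leqNgt; apply/negP => kn; move: ko.
rewrite -(subnKC kn) addSn -addnS expnD -mulnA muln2.
set y := 2 ^ (n - k.+1).+1 * _.
have -> : iter k half (2 ^ k * y) = y.
  move: y => y; elim: k {kmin kn} => [|k IH]; rewrite ?mul1n //.
  by rewrite iterSr expnS -mulnA mul2n doubleK.
by rewrite /y expnS -mulnA mul2n odd_double.
Qed.

Lemma ntlK n m : ntl (ncons n m) = m.
Proof. by rewrite /ntl nhdK half_ncons -addn1 halfD odd_double doubleK addn0. Qed.

Lemma ncons_inj n m n' m' : ncons n m = ncons n' m' -> n = n' /\ m = m'.
Proof.
by move=> e; have := congr1 nhd e; have := congr1 ntl e; rewrite !nhdK !ntlK.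
Qed.

Lemma ncons_gt0 n m : 0 < ncons n m.
Proof. by rewrite muln_gt0 expn_gt0. Qed.

Lemma rec1_nhd : rec1 nhd.
Proof.
pose g k x := (1 - odd (iter k half x)) * x.
have rg : rec2 g.
  apply: rec2_comp2 rec2_mul _ rec2_snd.
  apply: rec2_comp2 rec2_sub (rec2_const _) _.
  exact: rec2_comp1 rec1_odd (rec2_iter rec1_half).
apply: rec_mu rg _ _ => [v|v k].
  rewrite /g !(tnth_nth 0) /= inordK //= -(tnth_nth 0 v ord0) /nhd.
  by case: ex_minnP => k /orP[/eqP->|->] _; rewrite ?muln0.
rewrite /g !(tnth_nth 0) /= inordK //= /nhd.
case: ex_minnP => n _ nmin kn.
have /norP[/eqP x0 /negPf ->] : ~~ ((nth 0 v 0 == 0) || odd (iter k half (nth 0 v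
  0))).
  by apply/negP => /nmin; rewrite leqNgt kn.
by rewrite mul1n.
Qed.

Lemma rec1_ntl : rec1 ntl.
Proof.
apply: rec1_comp1 rec1_half _.
exact: rec1_comp2 (rec2_iter rec1_half) rec1_nhd rec1_id.
Qed.

(** * Computable functions on lists *)

(** [dflt] stands in for the head of the empty list. *)
Class encoding (T : Type) := Encoding {
  enc : T -> nat;
  enc_inj : injective enc;
  dflt : T }.

#[global] Instance nat_encoding : encoding nat :=
  {| enc := id; enc_inj := @inj_id nat; dflt := 0 |}.

Lemma nat_of_bool_inj : injective nat_of_bool.
Proof. by case; case. Qed.

#[global] Instance bool_encoding : encoding bool :=
  {| enc := nat_of_bool; enc_inj := nat_of_bool_inj; dflt := false |}.

Section SeqEncoding.
Context {T : Type} {eT : encoding T}.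

Definition enc_seq (s : seq T) := foldr (fun x c => ncons (enc x) c) 0 s.

Lemma enc_seq_inj : injective enc_seq.
Proof.
elim=> [|x s IH] [|y t] //.
- by move/eqP; rewrite eq_sym -leqn0 leqNgt ncons_gt0.
- by move/eqP; rewrite -leqn0 leqNgt ncons_gt0.
by move=> e; have [/(@enc_inj T) -> /IH ->] := ncons_inj e.
Qed.

#[global] Instance seq_encoding : encoding (seq T) :=
  {| enc := enc_seq; enc_inj := enc_seq_inj; dflt := [::] |}.

Lemma size_enc_seq s : size s <= enc_seq s.
Proof.
elim: s => //= x s IH; apply: leq_ltn_trans IH _.
rewrite /enc_seq /= -/(enc_seq s) /ncons; move: (enc_seq s) => c.
have : 0 < 2 ^ enc x by rewrite expn_gt0.
by nia.
Qed.

End SeqEncoding.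

Section PairEncoding.
Context {T U : Type} {eT : encoding T} {eU : encoding U}.

Definition enc_pair (p : T * U) := ncons (enc p.1) (enc p.2).

Lemma enc_pair_inj : injective enc_pair.
Proof.
move=> [x y] [x' y'] e.
by have [/(@enc_inj T)/= -> /(@enc_inj U)/= ->] := ncons_inj e.
Qed.

#[global] Instance pair_encoding : encoding (T * U) :=
  {| enc := enc_pair; enc_inj := enc_pair_inj; dflt := (dflt, dflt) |}.

End PairEncoding.

(** The values of [g] on numbers that encode nothing are irrelevant, so an
algorithm may assume that its input is well formed. *)
Definition computable (A B : Type) {eA : encoding A} {eB : encoding B}
    (f : A -> B) :=
  exists2 g : nat -> nat, rec1 g & forall a, g (enc a) = enc (f a).

Section Closure.
Context {A : Type} {eA : encoding A}.

Lemma computable_id : computable (fun a : A => a).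
Proof. by exists id => //; exact: rec1_id. Qed.

Lemma computable_const (B : Type) {eB : encoding B} (b : B) :
  computable (fun _ : A => b).
Proof. by exists (fun=> enc b) => //; exact: rec1_const. Qed.

Lemma computable_comp (B C : Type) {eB : encoding B} {eC : encoding C}
    (f : B -> C) (h : A -> B) :
  computable f -> computable h -> computable (fun a => f (h a)).
Proof.
move=> [f' rf fE] [h' rh hE]; exists (fun x => f' (h' x)).
  exact: rec1_comp1.
by move=> a; rewrite hE fE.
Qed.

Section Pairs.
Context {B C : Type} {eB : encoding B} {eC : encoding C}.

Lemma computable_pair (f : A -> B) (h : A -> C) :
  computable f -> computable h -> computable (fun a => (f a, h a)).
Proof.
move=> [f' rf fE] [h' rh hE]; exists (fun x => ncons (f' x) (h' x)).
  exact: rec1_comp2 rec2_ncons rf rh.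
by move=> a; rewrite hE fE.
Qed.

Lemma computable_fst (f : A -> B * C) :
  computable f -> computable (fun a => (f a).1).
Proof.
apply: (@computable_comp _ _ _ _ fst); exists nhd; first exact: rec1_nhd.
by move=> p; rewrite nhdK.
Qed.

Lemma computable_snd (f : A -> B * C) :
  computable f -> computable (fun a => (f a).2).
Proof.
apply: (@computable_comp _ _ _ _ snd); exists ntl; first exact: rec1_ntl.
by move=> p; rewrite ntlK.
Qed.

End Pairs.

Lemma computable_nat2 (h : nat -> nat -> nat) (f g : A -> nat) : rec2 h ->
  computable f -> computable g -> computable (fun a => h (f a) (g a)).
Proof.
move=> rh [f' rf fE] [g' rg gE]; exists (fun x => h (f' x) (g' x)).
  exact: rec1_comp2 rh rf rg.
by move=> a; rewrite fE gE.
Qed.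

Lemma computable_addn (f g : A -> nat) :
  computable f -> computable g -> computable (fun a => f a + g a).
Proof. exact: computable_nat2 rec2_add. Qed.

Lemma computable_succn (f : A -> nat) :
  computable f -> computable (fun a => (f a).+1).
Proof.
move=> cf; have := computable_addn (computable_const 1) cf.
by congr computable; apply: funext => a.
Qed.

Lemma computable_subn (f g : A -> nat) :
  computable f -> computable g -> computable (fun a => f a - g a).
Proof. exact: computable_nat2 rec2_sub. Qed.

Lemma computable_if (B : Type) {eB : encoding B} (c : A -> bool) (f g : A -> B) :
  computable c -> computable f -> computable g ->
  computable (fun a => if c a then f a else g a).
Proof.
move=> [c' rc cE] [f' rf fE] [g' rg gE].
exists (fun x => if c' x != 0 then f' x else g' x); last first.
  by move=> a; rewrite cE fE gE; case: (c a).
exact: rec1_if.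
Qed.

Lemma computable_eq (B : eqType) {eB : encoding B} (f g : A -> B) :
  computable f -> computable g -> computable (fun a => f a == g a).
Proof.
move=> [f' rf fE] [g' rg gE].
exists (fun x => 1 - ((f' x - g' x) + (g' x - f' x))); last first.
  move=> a; rewrite fE gE -(inj_eq enc_inj) /=; lia.
apply: rec1_comp2 rec2_sub (rec1_const 1) _.
by apply: rec1_comp2 rec2_add _ _; apply: rec1_comp2 rec2_sub _ _.
Qed.

Lemma computable_negb (f : A -> bool) :
  computable f -> computable (fun a => ~~ f a).
Proof.
by move=> cf; apply: computable_if cf _ _; exact: computable_const.
Qed.

Lemma computable_andb (f g : A -> bool) :
  computable f -> computable g -> computable (fun a => f a && g a).
Proof.
by move=> cf cg; apply: computable_if cf cg _; exact: computable_const.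
Qed.

Lemma computable_orb (f g : A -> bool) :
  computable f -> computable g -> computable (fun a => f a || g a).
Proof.
by move=> cf cg; apply: computable_if cf _ cg; exact: computable_const.
Qed.

Lemma computable_implb (f g : A -> bool) :
  computable f -> computable g -> computable (fun a => f a ==> g a).
Proof.
by move=> cf cg; apply: computable_if cf cg _; exact: computable_const.
Qed.

(** [rec2_iter] iterates a function of one number, so the parameter [a] travels
with the state. *)
Lemma computable_iter (B : Type) {eB : encoding B}
    (n : A -> nat) (f : A -> B -> B) (z : A -> B) :
  computable n -> computable (fun p : A * B => f p.1 p.2) -> computable z ->
  computable (fun a => iter (n a) (f a) (z a)).
Proof.
move=> [n' rn nE] [f' rf fE] [z' rz zE].
exists (fun x => ntl (iter (n' x) (fun c => ncons (nhd c) (f' c)) (ncons x (z' x)))).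
  apply: rec1_comp1 rec1_ntl _; apply: rec1_comp2 (rec2_iter _) rn _.
    exact: rec1_comp2 rec2_ncons rec1_nhd rf.
  exact: rec1_comp2 rec2_ncons rec1_id rz.
move=> a; rewrite nE zE /=.
set c0 := ncons _ _; set h := fun c : nat => _.
have -> : iter (n a) h c0 = ncons (enc a) (enc (iter (n a) (f a) (z a))).
  elim: (n a) => [//|k IH]; rewrite !iterS IH /h nhdK.
  by rewrite -(fE (a, iter k (f a) (z a))).
by rewrite ntlK.
Qed.

Section Lists.
Context {T : Type} {eT : encoding T}.

Lemma computable_cons (f : A -> T) (s : A -> seq T) :
  computable f -> computable s -> computable (fun a => f a :: s a).
Proof.
move=> [f' rf fE] [h' rh hE]; exists (fun x => ncons (f' x) (h' x)).
  exact: rec1_comp2 rec2_ncons rf rh.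
by move=> a; rewrite hE fE.
Qed.

Lemma computable_behead (s : A -> seq T) :
  computable s -> computable (fun a => behead (s a)).
Proof.
move=> [s' rs sE]; exists (fun x => ntl (s' x)); first exact: rec1_comp1 rec1_ntl rs.
move=> a; rewrite sE; case: (s a) => [|x t] /=; last by rewrite /enc_seq /= ntlK.
by rewrite /ntl iter_half0.
Qed.

Lemma computable_nilp (s : A -> seq T) :
  computable s -> computable (fun a => nilp (s a)).
Proof.
move=> [s' rs sE]; exists (fun x => 1 - s' x).
  exact: rec1_comp2 rec2_sub (rec1_const 1) rs.
move=> a; rewrite sE; case: (s a) => [|x t] //=.
by apply/eqP; rewrite subn_eq0; exact: ncons_gt0.
Qed.

Lemma computable_head x0 (s : A -> seq T) :
  computable s -> computable (fun a => head x0 (s a)).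
Proof.
move=> [s' rs sE]; exists (fun x => if s' x != 0 then nhd (s' x) else enc x0).
  exact: rec1_if rs (rec1_comp1 rec1_nhd rs) (rec1_const _).
move=> a; rewrite sE; case: (s a) => [|x t] //=.
by rewrite -lt0n /enc_seq /= ncons_gt0 nhdK.
Qed.

End Lists.
End Closure.

Ltac computable_step :=
  first [ exact: computable_id | exact: computable_const
        | apply: computable_fst | apply: computable_snd
        | apply: computable_pair | apply: computable_cons
        | apply: computable_behead | apply: computable_head
        | apply: computable_nilp | apply: computable_negb
        | apply: computable_andb | apply: computable_orb
        | apply: computable_implb | apply: computable_addn
        | apply: computable_succn | apply: computable_subn
        | apply: computable_eq
        | apply: computable_if ].

Lemma computable_ext {A B : Type} {eA : encoding A} {eB : encoding B}
    (f g : A -> B) : f =1 g -> computable f -> computable g.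
Proof. by move=> /funext ->. Qed.

Lemma computable_enc {A T : Type} {eA : encoding A} {eT : encoding T}
    (f : A -> T) : computable f -> computable (fun a => enc (f a)).
Proof. by move=> [f' rf fE]; exists f'. Qed.

(** A number and the list that it decodes to have the same code. *)
Lemma computable_decode {A : Type} {eA : encoding A} (f : A -> nat) :
  computable f -> computable (fun a => CodeSeq.decode (f a)).
Proof.
move=> [f' rf fE]; exists f' => // a; rewrite fE /= -{1}(CodeSeq.decodeK (f a)).
by rewrite /enc_seq /CodeSeq.code.
Qed.

Section ListIterators.
Context {A T : Type} {eA : encoding A} {eT : encoding T}.

(** The list is consumed from its head; its code exceeds its size and thus gives
enough steps. *)
Lemma computable_foldl (B : Type) {eB : encoding B}
    (f : A -> B -> T -> B) (z : A -> B) (s : A -> seq T) :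
  computable (fun p : A * B * T => f p.1.1 p.1.2 p.2) ->
  computable z -> computable s ->
  computable (fun a => foldl (f a) (z a) (s a)).
Proof.
move=> cf cz cs.
pose step a (p : seq T * B) :=
  (behead p.1, if nilp p.1 then p.2 else f a p.2 (head (@dflt T eT) p.1)).
have cstep : computable (fun p : A * (seq T * B) => step p.1 p.2).
  rewrite /step; repeat computable_step.
  by apply: (computable_comp (h := fun p : A * (seq T * B) =>
     (p.1, p.2.2, head (@dflt T eT) p.2.1)) cf); repeat computable_step.
have := computable_snd (computable_iter (computable_enc cs) cstep (computable_pair
  cs cz)).
congr computable; apply: funext => a.
have := @size_enc_seq T eT (s a); rewrite /=.
elim: (s a) (z a) (enc_seq _) => [|x t IH] y n.
  by move=> _; elim: n => // n IH; rewrite iterSr.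
by case: n => // n le_n; rewrite iterSr; exact: IH le_n.
Qed.

Lemma computable_rev (s : A -> seq T) :
  computable s -> computable (fun a => rev (s a)).
Proof.
move=> cs.
have step : computable (fun p : A * seq T * T => p.2 :: p.1.2).
  by repeat computable_step.
apply: computable_ext (computable_foldl (f := fun _ l x =>
  x :: l) step (computable_const [::]) cs) => a.
by rewrite /rev; elim: (s a) [::] => //= x l IH l'; rewrite IH.
Qed.
End ListIterators.

Section ListIterators.
Context {A T : Type} {eA : encoding A} {eT : encoding T}.

Lemma computable_foldr (B : Type) {eB : encoding B}
    (f : A -> T -> B -> B) (z : A -> B) (s : A -> seq T) :
  computable (fun p : A * T * B => f p.1.1 p.1.2 p.2) ->
  computable z -> computable s ->
  computable (fun a => foldr (f a) (z a) (s a)).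
Proof.
move=> cf cz cs.
have cf' : computable (fun p : A * B * T => f p.1.1 p.2 p.1.2).
  by apply: (computable_comp (h := fun p : A * B * T => (p.1.1, p.2, p.1.2)) cf);
    repeat computable_step.
have /= := @computable_foldl A T _ _ B _ (fun a y x =>
  f a x y) z _ cf' cz (computable_rev cs).
by congr computable; apply: funext => a; rewrite foldl_rev.
Qed.

Lemma computable_map (B : Type) {eB : encoding B} (f : A -> T -> B)
    (s : A -> seq T) :
  computable (fun p : A * T => f p.1 p.2) -> computable s ->
  computable (fun a => map (f a) (s a)).
Proof.
move=> cf cs; apply: (computable_foldr (f := fun a x l => f a x :: l)) _ _ cs.
  apply: computable_cons; last by repeat computable_step.
  by apply: (computable_comp (h := fst) cf); repeat computable_step.
exact: computable_const.
Qed.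

Lemma computable_filter (f : A -> T -> bool) (s : A -> seq T) :
  computable (fun p : A * T => f p.1 p.2) -> computable s ->
  computable (fun a => filter (f a) (s a)).
Proof.
move=> cf cs.
apply: (computable_foldr (f := fun a x l => if f a x then x :: l else l)) _ _ cs.
  repeat computable_step.
  by apply: (computable_comp (h := fst) cf); repeat computable_step.
exact: computable_const.
Qed.

Lemma computable_all (f : A -> T -> bool) (s : A -> seq T) :
  computable (fun p : A * T => f p.1 p.2) -> computable s ->
  computable (fun a => all (f a) (s a)).
Proof.
move=> cf cs; apply: (computable_foldr (f := fun a x r => f a x && r)) _ _ cs.
  repeat computable_step.
  by apply: (computable_comp (h := fst) cf); repeat computable_step.
exact: computable_const.
Qed.

Lemma computable_has (f : A -> T -> bool) (s : A -> seq T) :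
  computable (fun p : A * T => f p.1 p.2) -> computable s ->
  computable (fun a => has (f a) (s a)).
Proof.
move=> cf cs; apply: (computable_foldr (f := fun a x r => f a x || r)) _ _ cs.
  repeat computable_step.
  by apply: (computable_comp (h := fst) cf); repeat computable_step.
exact: computable_const.
Qed.

Lemma computable_cat (s t : A -> seq T) :
  computable s -> computable t -> computable (fun a => s a ++ t a).
Proof.
move=> cs ct.
have step : computable (fun p : A * T * seq T => p.1.2 :: p.2).
  by repeat computable_step.
apply: computable_ext (computable_foldr (f := fun _ x l => x :: l) step ct cs) => a.
by elim: (s a) => //= x l ->.
Qed.

Lemma computable_size (s : A -> seq T) :
  computable s -> computable (fun a => size (s a)).
Proof.
move=> cs.
have step : computable (fun p : A * T * nat => p.2.+1).
  by repeat computable_step.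
apply: computable_ext (computable_foldr (f := fun _ _ n =>
  n.+1) step (computable_const 0) cs) => a.
by elim: (s a) => //= x l ->.
Qed.

Lemma computable_drop (n : A -> nat) (s : A -> seq T) :
  computable n -> computable s -> computable (fun a => drop (n a) (s a)).
Proof.
move=> cn cs.
have step : computable (fun p : A * seq T => behead p.2).
  by repeat computable_step.
apply: computable_ext (computable_iter (f := fun _ => behead) cn step cs) => a.
elim: (n a) (s a) => [|k IH] l; first by rewrite drop0.
by rewrite iterSr IH; case: l => [|x l] /=; case: k {IH}.
Qed.

Lemma computable_nth x0 (s : A -> seq T) (n : A -> nat) :
  computable s -> computable n -> computable (fun a => nth x0 (s a) (n a)).
Proof.
move=> cs cn; have := computable_head x0 (computable_drop cn cs).
by congr computable; apply: funext => a; rewrite -nth0 nth_drop addn0.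
Qed.

Lemma computable_nseq (n : A -> nat) (f : A -> T) :
  computable n -> computable f -> computable (fun a => nseq (n a) (f a)).
Proof.
move=> cn cf; apply: (computable_iter (f := fun a => cons (f a))) cn _ _.
  apply: computable_cons; last by repeat computable_step.
  by apply: (computable_comp (h := fst) cf); repeat computable_step.
exact: computable_const.
Qed.

End ListIterators.

Lemma computable_index {A} {eA : encoding A} (T : eqType) {eT : encoding T}
    (f : A -> T) (s : A -> seq T) :
  computable f -> computable s -> computable (fun a => index (f a) (s a)).
Proof.
move=> cf cs.
apply: (computable_foldr (f := fun a x n => if x == f a then 0 else n.+1)) _ _ cs.
  repeat computable_step.
  by apply: (computable_comp (h := fun p => p.1.1) cf); repeat computable_step.
exact: computable_const.
Qed.

Lemma computable_iota {A} {eA : encoding A} (m n : A -> nat) :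
  computable m -> computable n -> computable (fun a => iota (m a) (n a)).
Proof.
move=> cm cn.
have := computable_iter
  (f := fun a s => rcons s (m a + size s)) cn _ (computable_const [::]).
move=> H; have {H} := H _.
have -> : (fun a : A => iter (n a) (fun s => rcons s (m a + size s)) [::]) =
  (fun a => iota (m a) (n a)).
  apply: funext => a; elim: (n a) => // k; rewrite iterS => ->.
  by rewrite size_iota -cats1 -(iotaD _ k 1) addn1.
apply; under eq_fun do rewrite -cats1.
apply: computable_cat; first by repeat computable_step.
repeat computable_step.
  by apply: (computable_comp (h := fst) cm); repeat computable_step.
by apply: computable_size; repeat computable_step.
Qed.

Section MoreLists.
Context {A T : Type} {eA : encoding A} {eT : encoding T}.

Lemma computable_take (n : A -> nat) (s : A -> seq T) :
  computable n -> computable s -> computable (fun a => take (n a) (s a)).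
Proof.
move=> cn cs.
have := computable_rev (computable_drop
  (computable_subn (computable_size cs) cn) (computable_rev cs)).
apply: computable_ext => a; rewrite drop_rev revK.
have [le|lt] := leqP (n a) (size (s a)); first by rewrite subKn.
by rewrite !take_oversize //; lia.
Qed.

Lemma computable_flatten (s : A -> seq (seq T)) :
  computable s -> computable (fun a => flatten (s a)).
Proof.
move=> cs; apply: (computable_foldr (f := fun _ => cat)) _ _ cs;
  last exact: computable_const.
by apply: computable_cat; repeat computable_step.
Qed.

Lemma computable_rcons (s : A -> seq T) (f : A -> T) :
  computable s -> computable f -> computable (fun a => rcons (s a) (f a)).
Proof.
move=> cs cf; have := computable_cat cs (computable_cons cf (computable_const [::])).
by apply: computable_ext => a; rewrite cats1.
Qed.

End MoreLists.

Lemma computable_mem {A} {eA : encoding A} (T : eqType) {eT : encoding T}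
    (f : A -> T) (s : A -> seq T) :
  computable f -> computable s -> computable (fun a => f a \in s a).
Proof.
move=> cf cs.
have H : computable (fun a => has (fun x => x == f a) (s a)).
  apply: computable_has cs; apply: computable_eq; first by repeat computable_step.
  by apply: (computable_comp (h := fst) cf); repeat computable_step.
by apply: computable_ext H => a; rewrite -has_pred1.
Qed.

Lemma computable_sumn {A} {eA : encoding A} (s : A -> seq nat) :
  computable s -> computable (fun a => sumn (s a)).
Proof.
move=> cs; apply: (computable_foldr (f := fun _ => addn)) _ _ cs;
  last exact: computable_const.
by repeat computable_step.
Qed.

Ltac computable_list_step :=
  first [ computable_step
        | apply: computable_cat | apply: computable_rcons
        | apply: computable_take | apply: computable_drop
        | apply: computable_size | apply: computable_nth
        | apply: computable_iota | apply: computable_flatten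
        | apply: computable_sumn | apply: computable_nseq
        | apply: computable_mem | apply: computable_index
        | apply: computable_decode
        | apply: computable_map | apply: computable_filter
        | apply: computable_all | apply: computable_has
        | apply: computable_iter ].

Ltac prove_computable := repeat (computable_list_step; simpl).

(** * Tuples as lists *)

Section Lists.
Variable T : eqType.
Implicit Types (Q l : seq T) (n : nat).

Definition lists Q n : seq (seq T) :=
  iter n (fun L => flatten [seq [seq x :: l | l <- L] | x <- Q]) [:: [::]].

Lemma mem_lists Q n l : (l \in lists Q n) = (size l == n) && all (mem Q) l.
Proof.
elim: n l => [|n IH] l; first by case: l.
rewrite /lists iterS -/(lists Q n); apply/flatten_mapP/idP => /=.
  by move=> [x xQ /mapP[l' l'in ->]]; move: l'in; rewrite IH eqSS /= xQ.
case: l => [//|x l]; rewrite /= eqSS => /and3P[sl xQ lQ]; exists x => //.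
by apply: map_f; rewrite IH sl.
Qed.

End Lists.

(** The maps from [{0, ..., n-1}] to [{0, ..., N-1}], in list form; they
reindex [N]-tuples into [n]-tuples. *)
Definition words n N := lists (iota 0 N) n.

Lemma mem_words n N w : (w \in words n N) = (size w == n) && all (gtn N) w.
Proof.
rewrite mem_lists; congr andb; apply: eq_all => i.
by rewrite /= mem_iota.
Qed.

Lemma size_words n N w : w \in words n N -> size w = n.
Proof. by rewrite mem_words => /andP[/eqP]. Qed.

Lemma words_lt n N w i : w \in words n N -> i < n -> nth 0 w i < N.
Proof.
rewrite mem_words => /andP[/eqP sw /allP wN] i_n.
by apply: wN; rewrite mem_nth ?sw.
Qed.

Lemma words_widen n N N' w : N <= N' -> w \in words n N -> w \in words n N'.
Proof.
move=> le; rewrite !mem_words => /andP[-> /=]; apply: sub_all => i /=.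
by move=> h; apply: leq_trans h le.
Qed.

Section Selection.
Variables (T : Type) (x0 : T).
Implicit Types (x : seq T) (u v : seq nat).

(** The composite of the tuple [x] with the reindexing [u]. *)
Definition sel x u := [seq nth x0 x i | i <- u].

Lemma size_sel x u : size (sel x u) = size u.
Proof. by rewrite size_map. Qed.

Lemma nth_sel x u i : i < size u -> nth x0 (sel x u) i = nth x0 x (nth 0 u i).
Proof. by move=> iu; rewrite (nth_map 0). Qed.

Lemma sel_cat x u v : sel x (u ++ v) = sel x u ++ sel x v.
Proof. exact: map_cat. Qed.

Lemma sel_nseq x n i : sel x (nseq n i) = nseq n (nth x0 x i).
Proof. exact: map_nseq. Qed.

Lemma sel_iota x m n : m + n <= size x -> sel x (iota m n) = take n (drop m x).
Proof.
move=> le; apply: (@eq_from_nth _ x0).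
  by rewrite size_sel size_iota size_takel // size_drop; lia.
move=> i; rewrite size_sel size_iota => lt_in.
by rewrite nth_sel ?size_iota // nth_iota // nth_take // nth_drop.
Qed.

Lemma sel_iota0 x n : n <= size x -> sel x (iota 0 n) = take n x.
Proof. by move=> le; rewrite sel_iota // drop0. Qed.

Lemma sel_id x : sel x (iota 0 (size x)) = x.
Proof. by rewrite sel_iota // drop0 take_size. Qed.

Lemma take_sel n x u : take n (sel x u) = sel x (take n u).
Proof. by rewrite /sel map_take. Qed.

Lemma sel_catl x y u : all (gtn (size x)) u -> sel (x ++ y) u = sel x u.
Proof. by move=> /allP h; apply/eq_in_map => i /h /= lt; rewrite nth_cat lt. Qed.

End Selection.

Lemma sel_sel (T : Type) (x0 : T) x u v : all (gtn (size u)) v ->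
  sel x0 x (sel 0 u v) = sel x0 (sel x0 x u) v.
Proof.
move=> /allP h; rewrite /sel -map_comp; apply/eq_in_map => i /h /= lt.
by rewrite -nth_sel.
Qed.

Lemma map_sel (T U : Type) (x0 : T) (y0 : U) (g : T -> U) x u :
  all (gtn (size x)) u -> map g (sel x0 x u) = sel y0 (map g x) u.
Proof.
move=> /allP h; rewrite /sel -map_comp; apply/eq_in_map => i /h /= lt.
by rewrite (nth_map x0).
Qed.

Lemma words_all n N w : w \in words n N -> all (gtn N) w.
Proof. by rewrite mem_words => /andP[]. Qed.

Lemma sel_words n m N w f :
  w \in words n N -> f \in words m n -> sel 0 w f \in words m N.
Proof.
move=> wN fn; rewrite mem_words size_sel (size_words fn) eqxx /=.
apply/allP => _ /mapP[i if_ ->] /=; apply: words_lt wN _.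
exact: (allP (words_all fn)).
Qed.

Lemma iota_words m n N : m + n <= N -> iota m n \in words n N.
Proof.
move=> le; rewrite mem_words size_iota eqxx; apply/allP => i.
by rewrite mem_iota /=; lia.
Qed.

Lemma cat_words n n' N w w' :
  w \in words n N -> w' \in words n' N -> w ++ w' \in words (n + n') N.
Proof.
rewrite !mem_words size_cat all_cat.
by move=> /andP[/eqP-> ->] /andP[/eqP-> ->]; rewrite eqxx.
Qed.

Lemma nseq_words n N i : i < N -> nseq n i \in words n N.
Proof. by move=> iN; rewrite mem_words size_nseq eqxx all_nseq /= iN orbT. Qed.

Section EqSelection.
Variables (T : eqType) (x0 : T).
Implicit Types (x y z : seq T) (u v : seq nat).

Lemma mem_sel x n u : u \in words n (size x) -> {subset sel x0 x u <= x}.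
Proof.
move=> ux _ /mapP[i iu ->]; apply: mem_nth.
exact: (allP (words_all ux)).
Qed.

Definition pos x z := [seq index d x | d <- z].

Lemma sel_pos x z : {subset z <= x} -> sel x0 x (pos x z) = z.
Proof.
move=> zx; rewrite /sel /pos -map_comp -[RHS]map_id.
by apply/eq_in_map => d /zx dx; rewrite /= nth_index.
Qed.

Lemma pos_words x z : {subset z <= x} -> pos x z \in words (size z) (size x).
Proof.
move=> zx; rewrite mem_words size_map eqxx; apply/allP => _ /mapP[d /zx dx ->].
by rewrite /= index_mem.
Qed.

End EqSelection.

(** * Quantifier-free types *)

Section QfTypes.
Variables (tau : signature) (D : choiceType) (d0 : D) (Delta : structure tau D).
Implicit Types (x y z : seq D) (s : tau).

Local Notation "x @ u" := (sel d0 x u) (at level 20).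

Definition holds_rel s z := Delta [tuple nth d0 z i | i < ar s].

Lemma holds_relP s (t : (ar s).-tuple D) : Delta t <-> holds_rel s t.
Proof.
rewrite /holds_rel; suff -> : [tuple nth d0 t i | i < ar s] = t by [].
by apply: eq_from_tnth => i; rewrite tnth_mktuple (tnth_nth d0).
Qed.

Lemma holds_rel_eq s z z' : (forall i, i < ar s -> nth d0 z i = nth d0 z' i) ->
  holds_rel s z = holds_rel s z'.
Proof.
move=> h; rewrite /holds_rel; congr Delta.
by apply: eq_from_tnth => i; rewrite !tnth_mktuple h.
Qed.

(** By homogeneity ([same_type_automorphism] below) this is the relation of lying
in one orbit of the automorphism group. *)
Definition same_type x y :=
  [/\ size x = size y,
      forall i j, i < size x -> j < size x ->
        (nth d0 x i == nth d0 x j) = (nth d0 y i == nth d0 y j)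
    & forall s v, v \in words (ar s) (size x) ->
        holds_rel s (x @ v) <-> holds_rel s (y @ v)].

Lemma same_type_refl x : same_type x x. Proof. by split. Qed.

Lemma same_type_sym x y : same_type x y -> same_type y x.
Proof.
move=> [sxy exy rxy]; split=> [//|i j|s v]; rewrite -sxy => *.
  by rewrite exy.
by rewrite rxy.
Qed.

Lemma same_type_trans y x z : same_type x y -> same_type y z -> same_type x z.
Proof.
move=> [sxy exy rxy] [syz eyz ryz]; split=> [|i j ix jx|s v vx].
- by rewrite sxy.
- by rewrite exy // eyz // -sxy.
- by rewrite rxy // ryz // -sxy.
Qed.

Lemma same_type_sel n x y u : same_type x y -> u \in words n (size x) ->
  same_type (x @ u) (y @ u).
Proof.
move=> [sxy exy rxy] ux; split; rewrite !size_sel //.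
  move=> i j iu ju.
  by rewrite !nth_sel // exy //; rewrite (words_lt ux) // -(size_words ux).
move=> s v vu; have uvx : sel 0 u v \in words (ar s) (size x).
  by apply: (sel_words ux); rewrite -(size_words ux).
by rewrite -!sel_sel ?(words_all vu) //; exact: rxy.
Qed.

Lemma same_type_holds x y s : ar s <= size x -> same_type x y ->
  holds_rel s x <-> holds_rel s y.
Proof.
move=> sx [sxy _ rxy].
have := rxy s (iota 0 (ar s)) (@iota_words 0 _ _ sx).
rewrite (@holds_rel_eq s (x @ _) x) ?(@holds_rel_eq s (y @ _) y) //;
  by move=> i lt; rewrite nth_sel ?size_iota ?nth_iota.
Qed.

Definition automorphism (g : D -> D) := isomorphism Delta Delta g.

Lemma automorphism_same_type g x : automorphism g -> same_type x (map g x).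
Proof.
move=> [gbij gpres]; split=> [|i j ix jx|s v vx]; first by rewrite size_map.
  by rewrite !(nth_map d0) // (inj_eq (bij_inj gbij)).
rewrite -(map_sel d0) ?(words_all vx) // /holds_rel gpres.
set t := map_tuple _ _; set t' := [tuple _ | _ < _].
suff -> : t = t' by [].
apply: eq_from_tnth => i; rewrite tnth_map !tnth_mktuple (nth_map d0) //.
by rewrite size_sel (size_words vx).
Qed.

(** An isomorphism of finite structures amounts to two enumerations of the same
type.  The maps [eT] and [eU] into [D] make this usable both for substructures
of [D] and for copies inside an abstract finite structure. *)
Lemma same_type_isomorphism (T U : Type) (M : structure tau T) (N : structure tau U)
    (eT : T -> D) (eU : U -> D) x y (f : T -> U) :
  injective eT -> injective eU ->
  (forall s t, M s t <-> holds_rel s (map eT t)) ->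
  (forall s t, N s t <-> holds_rel s (map eU t)) ->
  same_type x y ->
  (forall a, eT a \in x) -> (forall d, d \in x -> exists a, eT a = d) ->
  (forall b, eU b \in y) ->
  (forall a, eU (f a) = nth d0 y (index (eT a) x)) ->
  isomorphism M N f.
Proof.
move=> iT iU hM hN [sxy exy rxy] Tx xT Uy fE; split.
  have idx a : index (eT a) x < size x by rewrite index_mem.
  have finj : injective f.
    move=> a a' /(congr1 eU); rewrite !fE => /eqP; rewrite -exy // !nth_index //.
    by move=> /eqP /iT.
  have fsurj b : exists a, f a = b.
    have := nth_index d0 (Uy b); set j := index _ _ => yj.
    have jx : j < size x by rewrite sxy index_mem.
    have [a ea] := xT _ (mem_nth d0 jx); exists a; apply: iU; rewrite fE -yj.
    by apply/eqP; rewrite -exy // ea nth_index // mem_nth.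
  exists (fun b => sval (cid (fsurj b))) => [a|b]; last by case: cid.
  by apply: finj; case: cid.
move=> s t; rewrite hM hN.
pose v := pos x (map eT t).
have sub : {subset map eT t <= x}.
  by apply/allP; rewrite all_map; elim: (tval t) => //= a l ->; rewrite Tx.
have vx : v \in words (ar s) (size x).
  by have := pos_words sub; rewrite size_map size_tuple.
rewrite -(sel_pos d0 sub) rxy //.
rewrite /sel /pos /= -!map_comp.
by under [map (eU \o f) _]eq_map => a do rewrite /= fE.
Qed.

(** Homogeneity, with tuples in place of finite sets. *)
Lemma same_type_automorphism x y : homogeneous Delta -> same_type x y ->
  exists2 g, automorphism g & map g x = y.
Proof.
move=> hom exy; have [sxy _ _] := exy.
pose X : set D := [set d | d \in x]%classic.
pose Y : set D := [set d | d \in y]%classic.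
have fX : finite_set X by apply/finite_seqP; exists x.
have fY : finite_set Y by apply/finite_seqP; exists y.
have XP (a : X) : val a \in x by exact: set_valP a.
have fP (a : X) : nth d0 y (index (val a) x) \in Y.
  by apply/mem_set; rewrite /Y /= mem_nth // -sxy index_mem XP.
pose f (a : X) : Y := SigSub (fP a).
have [g [gaut gE]] : exists a : D -> D, isomorphism Delta Delta a /\
    forall p : X, a (val p) = val (f p).
  apply: hom fX fY _.
  apply: (@same_type_isomorphism _ _ _ _ val val x y) => //.
  - by move=> s t; rewrite /induced holds_relP.
  - by move=> s t; rewrite /induced holds_relP.
  - by move=> d dx; exists (SigSub (mem_set dx : d \in X)).
  - by move=> b; exact: set_valP b.
exists g => //; apply: (@eq_from_nth _ d0); rewrite size_map // => i ix.
rewrite (nth_map d0) //.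
have := gE (SigSub (mem_set (mem_nth d0 ix) : nth d0 x i \in X)).
move=> /= ->; apply/eqP; case: exy => _ <- //.
  by rewrite nth_index // mem_nth.
by rewrite index_mem mem_nth.
Qed.

End QfTypes.

(** * Finitely many colours of tuples *)

Section Colours.
Variables (tau : signature) (D : choiceType) (d0 : D) (Delta : structure tau D).
Variable b : nat.
Hypothesis b_gt2 : 2 < b.
(* The factor 2 lets two argument tuples of a symbol fit into one [b]-tuple. *)
Hypothesis b_ar : forall s : tau, (ar s).*2 <= b.
Implicit Types (x y z : seq D) (s : tau).

Local Notation "x @ u" := (sel d0 x u) (at level 20).
Local Notation holds_rel := (holds_rel d0 Delta).
Local Notation same_type := (same_type d0 Delta).

(** [inl (i, j)] stands for the equation between the coordinates [i] and [j],
[inr (s, v)] for the relation [s] at the coordinates listed in [v]. *)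
Definition atom := ((nat * nat) + (tau * seq nat))%type.

Definition atoms : seq atom :=
  [seq inl (i, j) | i <- iota 0 b, j <- iota 0 b] ++
  [seq inr (s, v) | s <- enum tau, v <- words (ar s) b].

Definition atom_holds z (a : atom) : bool :=
  match a with
  | inl (i, j) => nth d0 z i == nth d0 z j
  | inr (s, v) => `[< holds_rel s (z @ v) >]
  end.

(** The truth values of all atoms: a complete invariant of the type of a
[b]-tuple, with finitely many values. *)
Definition colour z : nat :=
  CodeSeq.code [seq nat_of_bool (atom_holds z a) | a <- atoms].

Lemma colourP x y : size x = b -> size y = b ->
  (colour x = colour y <-> same_type x y).
Proof.
move=> sx sy; split=> [/(can_inj CodeSeq.codeK)/eq_in_map exy|exy].
  split=> [|i j ix jx|s v vx]; first by rewrite sx.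
    have/exy/nat_of_bool_inj // : (inl (i, j) : atom) \in atoms.
    rewrite mem_cat; apply/orP; left; apply/allpairsP; exists (i, j).
    by rewrite !mem_iota /= -sx.
  have/exy/nat_of_bool_inj /= e : (inr (s, v) : atom) \in atoms.
    rewrite mem_cat; apply/orP; right; apply/allpairsPdep; exists s, v.
    by rewrite mem_enum -sx.
  by split=> /asboolP h; apply/asboolP; rewrite ?e // -e.
congr CodeSeq.code; apply/eq_in_map => a; rewrite mem_cat => /orP[|].
  move=> /allpairsP[[i j]] /=; rewrite !mem_iota /= => -[ib jb ->] /=.
  by case: exy => _ -> //; rewrite sx.
move=> /allpairsPdep[s [v [_ vb ->]]] /=; congr nat_of_bool.
by case: exy => _ _ h; apply/asbool_equiv_eq/h; rewrite sx.
Qed.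

(** Every atom mentions at most [b] coordinates, hence can be read off a
[b]-subtuple; shorter lists of coordinates are padded by repetition. *)
Lemma same_typeP x y : same_type x y <->
  size x = size y /\
  {in words b (size x), forall w, colour (x @ w) = colour (y @ w)}.
Proof.
split=> [exy|[sxy exy]].
  split=> [|w wx]; first by case: exy.
  apply/colourP; rewrite ?size_sel ?(size_words wx) //.
  exact: same_type_sel wx.
have eqw w : w \in words b (size x) -> same_type (x @ w) (y @ w).
  by move=> wx; apply/colourP; rewrite ?size_sel ?(size_words wx) // exy.
split=> // [i j ix jx|s v vx].
  have wx : i :: nseq b.-1 j \in words b (size x).
    have -> : b = 1 + b.-1 by lia.
    exact: cat_words (@nseq_words 1 _ _ ix) (nseq_words _ jx).
  case: (eqw _ wx) => _ e _; have := e 0 1; rewrite size_sel (size_words wx).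
  have [c ->] : exists c, b = c.+3 by exists (b - 3); lia.
  by apply.
case: (posnP (size x)) vx => [x0|x_gt0] vx.
  suff v0 : v = [::] by rewrite v0.
  by move: vx; rewrite x0 mem_words => /andP[_]; case: (v).
have wx : v ++ nseq (b - ar s) 0 \in words b (size x).
  have {2}-> : b = ar s + (b - ar s) by have := b_ar s; lia.
  exact: cat_words vx (nseq_words _ x_gt0).
case: (eqw _ wx) => _ _ /(_ s (iota 0 (ar s))); rewrite size_sel (size_words wx).
rewrite -!sel_sel ?size_cat ?size_nseq ?(size_words vx); last 2 first.
- by apply/allP => i; rewrite mem_iota /=; lia.
- by apply/allP => i; rewrite mem_iota /=; lia.
rewrite sel_iota ?size_cat ?(size_words vx) ?leq_addr //.
rewrite drop0 -(size_words vx) take_size_cat //; apply.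
by apply: iota_words; have := b_ar s; rewrite (size_words vx); lia.
Qed.

Definition colours : seq nat :=
  [seq c <- [seq CodeSeq.code (map nat_of_bool l) | l <- lists [:: true;
    false] (size atoms)]
  | `[< exists2 z, size z = b & colour z = c >]].

Lemma mem_colours c : c \in colours <-> exists2 z, size z = b & colour z = c.
Proof.
rewrite mem_filter; split=> [/andP[/asboolP //]|[z sz cz]].
apply/andP; split; first by apply/asboolP; exists z.
apply/mapP; exists (map (atom_holds z) atoms); last by rewrite -cz -map_comp.
by rewrite mem_lists size_map eqxx; apply/allP; case.
Qed.

Lemma colour_in z : size z = b -> colour z \in colours.
Proof. by move=> sz; apply/mem_colours; exists z. Qed.

(** How a colour changes when its tuple is reindexed by [f].  With finitely many
colours and reindexings this is a finite table. *)
Definition act c f : nat :=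
  if pselect (exists2 z, size z = b & colour z = c) is left p
  then colour (s2val (cid2 p) @ f) else 0.

Lemma colour_sel z f : size z = b -> f \in words b b ->
  colour (z @ f) = act (colour z) f.
Proof.
move=> sz fb; rewrite /act; case: pselect => [p|[]]; last by exists z.
case: (cid2 p) => z' sz' /= cz'; apply/colourP; rewrite ?size_sel ?(size_words fb) //.
have ezz' : same_type z z' by apply/colourP.
by apply: (same_type_sel (n := b)) => //; rewrite sz.
Qed.

End Colours.

(** * Realizing prescribed types *)

Section Realization.
Variables (tau : signature) (D : choiceType) (d0 : D) (Delta : structure tau D).
Variable b : nat.
Hypothesis b_gt2 : 2 < b.
Hypothesis b_ar : forall s : tau, (ar s).*2 <= b.
Variables (m : nat) (F : 'I_m -> fin_structure tau).
Hypothesis F_bounds : forall A : fin_structure tau,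
  age Delta A <-> forall i, ~ embeds (F i) (@rels _ A).
Hypothesis b_F : forall i, #|F i| <= b.
Variables (N : nat) (T : seq nat -> nat).
Hypothesis T_colour : {in words b N, forall w, T w \in colours d0 Delta b}.
Hypothesis T_act : {in words b N & words b b,
  forall w f, T (sel 0 w f) = act d0 Delta b (T w) f}.

Local Notation "x @ u" := (sel d0 x u) (at level 20).
Local Notation holds_rel := (holds_rel d0 Delta).
Local Notation same_type := (same_type d0 Delta).
Local Notation colour := (colour d0 Delta b).

(* A [b]-tuple of [D] with the colour prescribed for [w]. *)
Let X w : seq D :=
  if pselect (exists2 z, size z = b & colour z = T w) is left p
  then s2val (cid2 p) else [::].

Let XP w : w \in words b N -> size (X w) = b /\ colour (X w) = T w.
Proof.
move=> wN; rewrite /X; case: pselect => [p|[]]; first by case: cid2.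
by apply/mem_colours; exact: T_colour.
Qed.

Let sX w : w \in words b N -> size (X w) = b.
Proof. by move=> /XP[]. Qed.

Let X_sel w f : w \in words b N -> f \in words b b ->
  same_type (X (sel 0 w f)) (X w @ f).
Proof.
move=> wN fb; have swf := sel_words wN fb.
have [sw cw] := XP wN; have [swf' cwf] := XP swf.
apply/(@colourP _ _ d0 Delta b) => //; first by rewrite size_sel (size_words fb).
by rewrite cwf T_act // -cw colour_sel.
Qed.

Let pad v := v ++ nseq (b - size v) (head 0 v).

Let pad_words n M v : 0 < M -> n <= b -> v \in words n M -> pad v \in words b M.
Proof.
move=> M0 nb vM; rewrite /pad (size_words vM).
have {2}-> : b = n + (b - n) by lia.
apply: cat_words => //; apply: nseq_words.
by case: v vM => //= i v; rewrite mem_words => /andP[_ /andP[]].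
Qed.

Let sel_pad w v : v != [::] -> sel 0 w (pad v) = pad (sel 0 w v).
Proof.
by case: v => // i v _; rewrite /pad sel_cat sel_nseq size_sel.
Qed.

Let nth_pad v i : i < size v -> nth 0 (pad v) i = nth 0 v i.
Proof. by move=> lt; rewrite nth_cat lt. Qed.

(* [R s v]: the relation [s] is to hold at the coordinates [v]. *)
Let R s v := holds_rel s (X (pad v)).
(* [e i j]: the coordinates [i] and [j] are to be realized by the same point. *)
Let e i j := nth d0 (X (pad [:: i; j])) 0 == nth d0 (X (pad [:: i; j])) 1.

Let b_gt0 : 0 < b. Proof. by lia. Qed.

Let nth_X w i j : w \in words b N -> i < b -> j < b ->
  (nth d0 (X w) i == nth d0 (X w) j) = e (nth 0 w i) (nth 0 w j).
Proof.
move=> wN ib jb; have fb : pad [:: i; j] \in words b b.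
  by apply: (@pad_words 2) => //; rewrite ?mem_words /= ?ib ?jb //; lia.
have := X_sel wN fb; rewrite sel_pad // => -[_ h _].
have {h} := h 0 1; rewrite sX; last first.
  by rewrite -sel_pad //; exact: sel_words wN fb.
by move=> h; rewrite /e h //; lia.
Qed.

Let R_X w s v : w \in words b N -> v \in words (ar s) b ->
  R s (sel 0 w v) <-> holds_rel s (X w @ v).
Proof.
move=> wN vb; have ar_b : ar s <= b by have := b_ar s; lia.
have [v0|vn0] := eqVneq v [::].
  rewrite /R (@holds_rel_eq _ _ _ _ s _ (X w @ v)) //.
  by rewrite -(size_words vb) v0.
have fb := pad_words b_gt0 ar_b vb.
have wf : sel 0 w (pad v) \in words b N by exact: sel_words wN fb.
rewrite /R -sel_pad // (same_type_holds (s := s) _ (X_sel wN fb)) ?sX //.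
rewrite (@holds_rel_eq _ _ _ _ s _ (X w @ v)) // => i; rewrite -(size_words vb) => iv.
by rewrite !nth_sel ?nth_pad // (size_words fb) (leq_trans iv) // (size_words vb).
Qed.

Hypothesis N_gt0 : 0 < N.

Let e_refl i : i < N -> e i i.
Proof.
move=> iN; have wN : pad [:: i] \in words b N.
  by apply: (@pad_words 1) => //; rewrite mem_words /= iN.
by have := nth_X wN b_gt0 b_gt0; rewrite eqxx nth_pad //= => <-.
Qed.

Let e_trans i j k : i < N -> j < N -> k < N -> e i j -> e j k = e i k.
Proof.
move=> iN jN kN; have wN : pad [:: i; j; k] \in words b N.
  by apply: (@pad_words 3) => //; rewrite mem_words /= iN jN kN.
have b1 : 1 < b by lia.
have := nth_X wN b_gt0 b1; have := nth_X wN b_gt0 b_gt2; have := nth_X wN b1 b_gt2.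
by rewrite !nth_pad //= => <- <- <- /eqP ->.
Qed.

Let rep i := find (e i) (iota 0 N).

Let has_e i : i < N -> has (e i) (iota 0 N).
Proof.
by move=> iN; apply/hasP; exists i; rewrite ?mem_iota // e_refl.
Qed.

Let rep_lt i : i < N -> rep i < N.
Proof. by move=> /has_e; rewrite has_find size_iota. Qed.

Let e_rep i : i < N -> e i (rep i).
Proof.
move=> iN; have := nth_find 0 (has_e iN); rewrite nth_iota //; exact: rep_lt.
Qed.

Let e_repP i j : i < N -> j < N -> e i j = (rep i == rep j).
Proof.
move=> iN jN; apply/idP/eqP => [eij|rij].
  rewrite /rep; apply: eq_in_find => k; rewrite mem_iota /= add0n => kN.
  by rewrite (e_trans iN jN kN eij).
have := e_rep jN; rewrite -rij => ejr.
rewrite -(e_trans iN (rep_lt iN) jN (e_rep iN)).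
by rewrite (e_trans jN (rep_lt iN) jN ejr) e_refl.
Qed.

(* The prescribed structure lives on one representative of each [e]-class. *)
Let cell := {i : 'I_N | rep i == i}.
Let cell_nat (c : cell) : nat := val (val c).

Let cell_lt c : cell_nat c < N. Proof. exact: ltn_ord. Qed.

Let cell_inj : injective cell_nat.
Proof. by move=> c c' /val_inj/val_inj. Qed.

Let repK i : i < N -> rep (rep i) = rep i.
Proof. by move=> iN; apply/eqP; rewrite eq_sym -e_repP ?rep_lt // e_rep. Qed.

Let to_cell i (iN : i < N) : cell :=
  exist (fun j : 'I_N => rep j == j) (Ordinal (rep_lt iN))
    (introT eqP (repK iN)).

Let quotient := @FinStructure tau cell
  (fun s t => R s [seq cell_nat c | c <- t]).

(* A bound [F i] inside the quotient has at most [b] elements, so its image is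
described by the colour of one word [w].  That colour is realized by [X w], so
[F i] embeds into [D], which contradicts that it is a bound. *)
Let quotient_age : age Delta quotient.
Proof.
apply/F_bounds => i [f [finj fpres]].
suff : age Delta (F i).
  move/F_bounds/(_ i); apply; exists id; split=> // s t.
  by have -> : map_tuple id t = t by apply: val_inj; rewrite /= map_id.
pose v := [seq cell_nat (f p) | p <- enum (F i)].
have sv : size v = #|F i| by rewrite size_map -cardE.
have vN : v \in words #|F i| N.
  rewrite mem_words sv eqxx; apply/allP => _ /mapP[p _ ->]; exact: cell_lt.
have wN : pad v \in words b N by exact: pad_words vN.
have rk (p : F i) : enum_rank p < #|F i| by [].
have nthv (p : F i) : nth 0 (pad v) (enum_rank p) = cell_nat (f p).
  rewrite nth_pad ?sv // (nth_map p) -?cardE //.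
  by rewrite nth_enum_rank.
have rb (p : F i) : enum_rank p < b by exact: leq_trans (rk p) (b_F i).
exists (fun p => nth d0 (X (pad v)) (enum_rank p)); split.
  move=> p q /eqP; rewrite nth_X // !nthv e_repP ?cell_lt // => /eqP.
  rewrite (eqP (valP (f p))) (eqP (valP (f q))) => /cell_inj; exact: finj.
move=> s t; rewrite fpres /= (holds_relP d0).
pose u := [seq nat_of_ord (enum_rank p) | p <- t].
have ub : u \in words (ar s) b.
  rewrite mem_words size_map size_tuple eqxx.
  by apply/allP => _ /mapP[p _ ->] /=.
have <- : sel 0 (pad v) u = [seq cell_nat c | c <- map f t].
  by rewrite /sel /u -!map_comp; apply: eq_map => p /=; rewrite nthv.
by rewrite R_X // /sel -map_comp.
Qed.

(* One word contains both [v] and [map rep v], and [e] identifies them there. *)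
Let R_rep s v : v \in words (ar s) N -> R s v <-> R s (map rep v).
Proof.
move=> vN; have ar_b := b_ar s.
set v' := map rep v.
have v'N : v' \in words (ar s) N.
  rewrite mem_words size_map (size_words vN) eqxx.
  apply/allP => _ /mapP[i iv ->]; apply: rep_lt; exact: (allP (words_all vN)).
have wN : pad (v ++ v') \in words b N.
  by apply: pad_words (cat_words vN v'N); lia.
have ub : iota 0 (ar s) \in words (ar s) b by apply: iota_words; lia.
have u'b : iota (ar s) (ar s) \in words (ar s) b by apply: iota_words; lia.
have vE : sel 0 (pad (v ++ v')) (iota 0 (ar s)) = v.
  rewrite sel_iota ?(size_words wN); last by lia.
  by rewrite drop0 /pad -catA -{1}(size_words vN) take_size_cat.
have v'E : sel 0 (pad (v ++ v')) (iota (ar s) (ar s)) = v'.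
  rewrite sel_iota ?(size_words wN); last by lia.
  rewrite /pad -catA -{2}(size_words vN) drop_size_cat //.
  by rewrite -{1}(size_words v'N) take_size_cat.
rewrite -[Y in R s Y <-> _]vE -[Y in _ <-> R s Y]v'E !R_X //.
rewrite (@holds_rel_eq _ _ _ _ s _ (X (pad (v ++ v')) @ iota (ar s) (ar s))) //.
move=> i ia; rewrite !nth_sel ?size_iota // !nth_iota //; apply/eqP.
rewrite nth_X //; try lia.
have iv : i < size v by rewrite (size_words vN).
rewrite !nth_pad ?size_cat ?(size_words vN) ?(size_words v'N); try lia.
rewrite !nth_cat iv (size_words vN) ltnNge leq_addr /= addKn (nth_map 0) //.
by apply: e_rep; apply: (words_lt vN).
Qed.

Lemma realization_gt0 :
  exists2 x, size x = N & {in words b N, forall w, colour (x @ w) = T w}.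
Proof.
have [h [hinj hpres]] := quotient_age.
have d_cell : cell by exact: to_cell N_gt0.
pose cell_of i := if insub i is Some j then to_cell (ltn_ord j) else d_cell.
have cell_ofE i : i < N -> cell_nat (cell_of i) = rep i.
  by move=> iN; rewrite /cell_of insubT.
pose xi i := h (cell_of i).
exists (mkseq xi N); first by rewrite size_mkseq.
move=> w wN; have [sw cw] := XP wN; rewrite -cw.
have wlt i : i < b -> nth 0 w i < N by exact: words_lt wN.
apply/(@colourP _ _ d0 Delta b); rewrite ?size_sel ?(size_words wN) //.
split; rewrite !size_sel (size_words wN) ?sw //.
  move=> i j ib jb; rewrite nth_X // !nth_sel ?(size_words wN) //.
  rewrite !nth_mkseq ?wlt //.
  by rewrite (inj_eq hinj) -(inj_eq cell_inj) !cell_ofE -?e_repP ?wlt.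
move=> s v vb; have swv := sel_words wN vb.
rewrite -sel_sel ?(size_words wN) ?(words_all vb) // -R_X // R_rep //.
set u := sel 0 w v in swv *.
have su : size u = ar s := size_words swv.
have ult i : i < ar s -> nth 0 u i < N by exact: words_lt swv.
pose t := [tuple cell_of (nth 0 u i) | i < ar s].
have <- : [seq cell_nat c | c <- t] = map rep u.
  apply: (@eq_from_nth _ 0); first by rewrite size_map size_tuple size_map su.
  move=> i; rewrite size_map size_tuple => ia.
  rewrite (nth_map d_cell) ?size_tuple // (nth_map 0 _ rep) ?su //.
  by rewrite -[i]/(nat_of_ord (Ordinal ia)) -tnth_nth tnth_mktuple cell_ofE ?ult.
rewrite -[R s _]/(rels (f := quotient) t) hpres (holds_relP d0).
rewrite (@holds_rel_eq _ _ _ _ s _ (mkseq xi N @ u)) // => i ia.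
rewrite nth_sel ?su // nth_mkseq ?ult // (nth_map d_cell) ?size_tuple //.
by rewrite -[i]/(nat_of_ord (Ordinal ia)) -tnth_nth tnth_mktuple.
Qed.

End Realization.

(** Finite boundedness turns local consistency into existence: [T] prescribes a
finite structure on [N] points, up to the identifications it demands, and a
bound embedded in that structure would be visible in a single [b]-subtuple.
Since every [b]-subtuple is realized in [D], there is no such bound. *)
Lemma realization (tau : signature) (D : choiceType) (d0 : D)
    (Delta : structure tau D) (b : nat) (m : nat) (F : 'I_m -> fin_structure tau) :
  2 < b -> (forall s : tau, (ar s).*2 <= b) ->
  (forall A : fin_structure tau,
     age Delta A <-> forall i, ~ embeds (F i) (@rels _ A)) ->
  (forall i, #|F i| <= b) ->
  forall (N : nat) (T : seq nat -> nat),
  {in words b N, forall w, T w \in colours d0 Delta b} ->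
  {in words b N & words b b,
    forall w f, T (sel 0 w f) = act d0 Delta b (T w) f} ->
  exists2 x, size x = N &
    {in words b N, forall w, colour d0 Delta b (sel d0 x w) = T w}.
Proof.
move=> b2 bar FB bF [|N] T TQ Tact; last exact: realization_gt0 FB bF _ _ _ _ _.
exists [::] => // w; rewrite mem_words => /andP[/eqP sw].
by case: w sw => // e; move: b2; rewrite -e.
Qed.

(** * The Ramsey property for tuples *)

Section Ramsey.
Variables (tau : signature) (D : choiceType) (d0 : D) (Delta : structure tau D).
Hypothesis Delta_ordered : ordered (age Delta).
Hypothesis Delta_homogeneous : homogeneous Delta.
Hypothesis Delta_ramsey : ramsey (age Delta).
Implicit Types (x y z : seq D) (s : tau).

Local Notation "x @ u" := (sel d0 x u) (at level 20).
Local Notation holds_rel := (holds_rel d0 Delta).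
Local Notation same_type := (same_type d0 Delta).

Definition substructure x := @FinStructure tau (seq_sub x)
  (fun s t => holds_rel s (map val t)).

Lemma substructure_age x : age Delta (substructure x).
Proof.
exists val; split; first exact: val_inj.
by move=> s t; rewrite (holds_relP d0).
Qed.

(** The symbol may denote a strict order in one structure and a reflexive one in
another; off the diagonal both readings agree.  The axioms of a strict order
concern at most three points, so they can be checked in substructures of at
most three points. *)
Lemma strict_order : exists lt : rel D,
  [/\ irreflexive lt, transitive lt,
      forall d d', d != d' -> lt d d' || lt d' d
    & forall (x y : seq D) i j, same_type x y -> i < size x -> j < size x ->
        lt (nth d0 x i) (nth d0 x j) = lt (nth d0 y i) (nth d0 y j)].
Proof.
have [s [ar2 total]] := Delta_ordered.
pose le d d' := holds_rel s [:: d; d'].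
have {}total x : total_order (fun p q : substructure x => le (val p) (val q)).
  have := total _ (substructure_age x); congr total_order.
  apply/funext => p; apply/funext => q.
  by rewrite /= val_tcast.
pose lt d d' := (d != d') && `[< le d d' >].
have trans3 : transitive lt.
  move=> d c e /andP[cd /asboolP lcd] /andP[de /asboolP lde].
  pose S := [:: c; d; e].
  have cS : c \in S by rewrite !inE eqxx.
  have dS : d \in S by rewrite !inE eqxx orbT.
  have eS : e \in S by rewrite !inE eqxx !orbT.
  apply/andP; case: (total S) => -[h tr _];
    have lce : le c e := tr (SeqSub cS) (SeqSub dS) (SeqSub eS) lcd lde;
    split; try exact/asboolP.
    by apply/eqP => ece; apply: (h (SeqSub cS)); rewrite /= {2}ece.
  apply/eqP => ece; rewrite -ece in lde.
  have /(congr1 val)/= ecd := h (SeqSub cS) (SeqSub dS) lcd lde.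
  by rewrite ecd eqxx in cd.
exists lt; split=> [d||d d' dd'|x y i j exy ix jx].
- by rewrite /lt eqxx.
- exact: trans3.
- pose S := [:: d; d'].
  have dS : d \in S by rewrite !inE eqxx.
  have d'S : d' \in S by rewrite !inE eqxx orbT.
  rewrite /lt dd' eq_sym dd' /=.
  case: (total S) => -[_ _ /(_ (SeqSub dS) (SeqSub d'S))] /=.
    case=> [h|[/(congr1 val)/= e|h]].
    + by apply/orP; left; apply/asboolP.
    + by rewrite e eqxx in dd'.
    + by apply/orP; right; apply/asboolP.
  by case=> h; apply/orP; [left|right]; apply/asboolP.
rewrite /lt; case: (exy) => _ -> // _; congr andb.
have w2 : [:: i; j] \in words 2 (size x) by rewrite mem_words /= ix jx.
have := same_type_holds (s := s) _ (same_type_sel exy w2).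
by rewrite ar2 => /(_ isT)/asbool_equiv_eq.
Qed.

(** The order makes finite substructures rigid: an automorphism that permutes a
finite set preserves the number of smaller elements, hence fixes each point. *)
Lemma same_type_rigid x y : same_type x y -> x =i y -> x = y.
Proof.
move=> exy xy; have [lt [irr tr tot pres]] := strict_order.
have [sxy _ _] := exy.
have [g gaut gx] := same_type_automorphism Delta_homogeneous exy.
have ginj : injective g by case: gaut => /bij_inj.
have glt d d' : d \in x -> d' \in x -> lt (g d) (g d') = lt d d'.
  move=> dx dx'; have := pres _ _ (index d x) (index d' x) exy.
  by rewrite !index_mem !nth_index // => ->;
    rewrite // -gx !(nth_map d0) ?index_mem // !nth_index.
pose e := undup x.
have ge : perm_eq (map g e) e.
  apply: uniq_perm; rewrite ?(map_inj_uniq ginj) ?undup_uniq // => d.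
  have ex : e =i x by exact: mem_undup.
  by rewrite ex xy -gx; apply: eq_mem_map.
pose rank d := count (lt^~ d) e.
have rankg d : d \in x -> rank (g d) = rank d.
  move=> dx; rewrite /rank -(permP ge) count_map; apply: eq_in_count => d'.
  by rewrite /e mem_undup => d'x /=; rewrite glt.
have rank_lt d d' : d \in x -> lt d d' -> rank d < rank d'.
  move=> dx dd'; rewrite /rank -!size_filter.
  apply: (@uniq_leq_size _ (d :: [seq c <- e | lt c d])).
    by rewrite /= mem_filter irr /= filter_uniq ?undup_uniq.
  move=> c; rewrite inE !mem_filter => /orP[/eqP->|/andP[cd ->]].
    by rewrite dd' /e mem_undup.
  by rewrite (tr _ _ _ cd dd').
rewrite -gx -[LHS]map_id; apply/eq_in_map => d dx.
have gdx : g d \in x by rewrite xy -gx map_f.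
apply/eqP; apply: contraT => /tot /orP[] lt_d.
  by have := rank_lt _ _ dx lt_d; rewrite rankg // ltnn.
by have := rank_lt _ _ gdx lt_d; rewrite rankg // ltnn.
Qed.

Lemma embedding_same_type x (h : substructure x -> D) :
  embedding (@rels _ (substructure x)) Delta h ->
  exists2 y, same_type x y & forall d, d \in y -> exists a, h a = d.
Proof.
move=> [hinj hpres].
pose hx d := if insub d is Some a then h a else d0.
have hxE d (dx : d \in x) : hx d = h (SeqSub dx).
  by rewrite /hx insubT.
exists (map hx x); last first.
  by move=> _ /mapP[d dx ->]; exists (SeqSub dx); rewrite hxE.
split=> [|i j ix jx|s v vx]; first by rewrite size_map.
  rewrite !(nth_map d0) // !(hxE _ (mem_nth _ _)) (inj_eq hinj).
  by [].
have sx : {subset x @ v <= x} by exact: mem_sel vx.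
have sxv : size (x @ v) = ar s by rewrite size_sel (size_words vx).
rewrite -(map_sel d0) ?(words_all vx) //.
have [t tE] : exists t : (ar s).-tuple (seq_sub x), map val t = x @ v.
  have sz : size (pmap insub (x @ v) : seq (seq_sub x)) == ar s.
    by rewrite size_pmap_sub -sxv -all_count; apply/allP => d /sx.
  exists (Tuple sz); apply: etrans (pmap_filter _ _) _; first exact: insubK.
  by apply/all_filterP/allP => d /sx dx; rewrite insubT.
have := hpres s t; rewrite /= tE (holds_relP d0) => ->.
suff -> : map_tuple h t = map hx (x @ v) :> seq D by [].
by rewrite -tE -map_comp; apply: eq_map => -[d dx] /=; rewrite hxE.
Qed.

Lemma copy_of_pattern (S : fin_structure tau) (e : S -> D) z z' :
  embedding (@rels _ S) Delta e -> same_type z z' ->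
  (forall d, d \in z' -> exists a, e a = d) ->
  is_copy (substructure z) [set a : S | e a \in z']%classic.
Proof.
move=> [einj epres] ezz' z'e; set Y := [set a : S | _]%classic.
have [szz' _ _] := ezz'.
have Yz' (a : Y) : e (val a) \in z' by exact: set_valP a.
have ex (p : substructure z) : exists a : Y, e (val a) = nth d0 z' (index (val p) z).
  have lt : index (val p) z < size z' by rewrite -szz' index_mem (valP p).
  have [a ea] := z'e _ (mem_nth d0 lt).
  have aY : a \in Y by apply/mem_set; rewrite /Y /= ea mem_nth.
  by exists (SigSub aY).
exists (fun p => sval (cid (ex p))).
apply: (@same_type_isomorphism _ _ d0 Delta _ _ _ _ val (e \o val) z z') => //.
- by move=> a a' /= /einj/val_inj.
- by move=> s t; rewrite /induced epres (holds_relP d0) /= -map_comp.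
- by move=> a; exact: valP.
- by move=> d dz; exists (SeqSub dz).
- by move=> p; case: cid.
Qed.

Definition homogeneous_for (C : Type) (F : seq D -> C) x y z :=
  {in words (size z) (size x) &, forall u v,
    same_type z (x @ u) -> same_type z (x @ v) -> F (y @ u) = F (y @ v)}.

(** The Ramsey property colours sets.  By rigidity a set has at most one
enumeration with the type of [z], so a colouring of tuples of that type is a
colouring of the copies of [z]. *)
Lemma ramsey_pattern c x z : exists S : seq D, forall F : seq D -> 'I_c.+1,
  exists y, [/\ same_type x y, {subset y <= S} & homogeneous_for F x y z].
Proof.
have [S [[e [einj epres]] HS]] := Delta_ramsey (ltn0Sn c)
  (substructure_age x) (substructure_age z).
exists (map e (enum S)) => F.
pose enumerates z' (Y : set S) :=
  same_type z z' /\ forall d, d \in z' <-> exists2 a, Y a & e a = d.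
pose chi (Y : set S) : 'I_c.+1 :=
  if pselect (exists z', enumerates z' Y) is left p then F (sval (cid p)) else ord0.
have chiE z' Y : enumerates z' Y -> chi Y = F z'.
  move=> [ez' mz']; rewrite /chi; case: pselect => [p|[]]; last by exists z'.
  case: (cid p) => z'' [ez'' mz''] /=; congr F; apply: same_type_rigid.
    by apply: same_type_trans ez'; exact: same_type_sym.
  by move=> d; apply/idP/idP => [/mz''/mz'|/mz'/mz''].
have [X [[f [fbij fpres]] mono]] := HS chi.
have [|y exy yf] := @embedding_same_type x (fun a => e (val (f a))).
  split; first by move=> a a' /einj/val_inj/(bij_inj fbij).
  move=> s t; rewrite fpres /induced epres.
  suff -> : map_tuple e (map_tuple val (map_tuple f t)) =
    map_tuple (fun a => e (val (f a))) t by [].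
  by apply: eq_from_tnth => i; rewrite !tnth_map.
have [sxy _ _] := exy.
exists y; split=> // [d /yf[a <-]|u v ux vx ezu ezv].
  by rewrite map_f // mem_enum.
have yX a d : d \in y -> e a = d -> X a.
  by move=> /yf[a' <-] /einj ->; exact: set_valP.
pose Y w := [set a : S | e a \in y @ w]%classic.
have Yw w : w \in words (size z) (size x) -> same_type z (x @ w) ->
    [/\ (Y w `<=` X)%classic, is_copy (substructure z) (Y w) & chi (Y w) = F (y @ w)].
  move=> wx ezw; have wy : w \in words (size z) (size y) by rewrite -sxy.
  have sub := mem_sel (x0 := d0) wy.
  have ezy : same_type z (y @ w) by apply: same_type_trans ezw _;
    exact: same_type_sel wx.
  have ye d : d \in y @ w -> exists a, e a = d.
    by move=> /sub/yf[a <-]; exists (val (f a)).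
  split=> [a /sub ya||]; first exact: yX ya _.
    exact: copy_of_pattern.
  apply: chiE; split=> // d; split=> [dy|[a Ya <-//]].
  by have [a ea] := ye _ dy; exists a => //; rewrite /Y /= ea.
have [uX uc <-] := Yw _ ux ezu; have [vX vc <-] := Yw _ vx ezv.
exact: mono.
Qed.

(** Induction on the list of patterns: a set that is good for the first pattern
contains a copy of a set [S1] that is good for the others, and all tuples of
the first pattern in that copy already have one colour. *)
Lemma ramsey_patterns c x (Z : seq (seq D)) :
  exists S : seq D, forall F : seq D -> 'I_c.+1,
  exists y, [/\ same_type x y, {subset y <= S} &
    forall z, z \in Z -> homogeneous_for F x y z].
Proof.
elim: Z => [|z Z [S1 IH]].
  by exists x => F; exists x; split=> //; exact: same_type_refl.
have [S HS] := ramsey_pattern c S1 z; exists S => F.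
have [S1' [eS1 S1'S homz]] := HS F.
have [g gaut gS1] := same_type_automorphism Delta_homogeneous eS1.
have [y [exy yS1 homZ]] := IH (F \o map g).
have [sxy _ _] := exy.
have gsel u : all (gtn (size x)) u -> map g y @ u = map g (y @ u).
  by rewrite sxy => h; rewrite (map_sel d0 d0).
exists (map g y); split=> [|d /mapP[d' /yS1 d'S ->]|z'].
- by apply: same_type_trans exy _; exact: automorphism_same_type.
- by apply: S1'S; rewrite -gS1 map_f.
rewrite inE => /orP[/eqP->|z'Z] u v ux vx ezu ezv; last first.
  rewrite !gsel ?(words_all ux) ?(words_all vx) //.
  exact: homZ z'Z _ _ ux vx ezu ezv.
pose a := pos S1 y.
have aS1 : a \in words (size x) (size S1) by rewrite sxy; exact: pos_words.
have sa := size_words aS1.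
have ya w : w \in words (size z) (size x) -> same_type z (x @ w) ->
    [/\ sel 0 a w \in words (size z) (size S1), same_type z (S1 @ sel 0 a w) &
        map g y @ w = S1' @ sel 0 a w].
  move=> wx ezw; split; first exact: sel_words aS1 wx.
    rewrite sel_sel ?sa ?(words_all wx) // sel_pos //.
    by apply: same_type_trans ezw _; exact: same_type_sel wx.
  rewrite sel_sel ?sa ?(words_all wx) //; congr (sel d0 _ w).
  by rewrite -gS1 -(map_sel d0) ?(words_all aS1) // sel_pos.
have [u1 u2 ->] := ya _ ux ezu; have [v1 v2 ->] := ya _ vx ezv.
exact: homz.
Qed.

(** Naming the parameters [t] preserves the Ramsey property.  For every copy [c']
of [t] an automorphism [back c'] is fixed that moves [c'] to [t]; colouring a
tuple that starts with [c'] like its image under [back c'] gives a colouring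
without parameters, and [back c'] moves a homogeneous tuple that starts with
[c'] to one that starts with [t]. *)
Lemma ramsey_constants c k (t x : seq D) : take (size t) x = t ->
  exists S : seq D, forall F : seq D -> 'I_c.+1,
  exists y, [/\ same_type x y, take (size t) y = t, {subset y <= S} &
    {in words k (size x) &, forall u v,
      take (size t) u = iota 0 (size t) -> take (size t) v = iota 0 (size t) ->
      same_type (x @ u) (x @ v) -> F (y @ u) = F (y @ v)}].
Proof.
set m := size t => tx.
have m_x : m <= size x.
  by rewrite leqNgt; apply/negP => lt; move: tx;
    rewrite take_oversize ?(ltnW lt) // => xt; move: lt; rewrite xt ltnn.
have [S0 HS0] := ramsey_patterns c x [seq x @ u | u <- words k (size x)].
pose back c' : D -> D :=
  if pselect (exists2 g, automorphism Delta g & map g c' = t) is left p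
  then s2val (cid2 p) else id.
have backP c' : same_type c' t ->
  automorphism Delta (back c') /\ map (back c') c' = t.
  move=> ec; rewrite /back; case: pselect => [p|[]]; first by case: cid2.
  have [g ga gc] := same_type_automorphism Delta_homogeneous ec.
  by exists g.
exists (flatten [seq map (back c') S0 | c' <- lists S0 m]) => F.
have [y [exy yS0 homy]] := HS0 (fun z => F (map (back (take m z)) z)).
have [sxy _ _] := exy.
pose c' := take m y; have sc' : size c' = m by rewrite size_takel // -sxy.
have [gaut gc] : automorphism Delta (back c') /\ map (back c') c' = t.
  apply: backP; apply: same_type_sym.
  have -> : t = x @ iota 0 m by rewrite sel_iota // drop0 tx.
  have -> : c' = y @ iota 0 m by rewrite sel_iota ?drop0 // -sxy.
  by apply: (same_type_sel exy); exact: iota_words.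
exists (map (back c') y); split=> [||d dy|u v ux vx um vm euv].
- by apply: same_type_trans exy _; exact: automorphism_same_type.
- by rewrite -map_take.
- apply/flatten_mapP; exists c'; last first.
    by case/mapP: dy => d' /yS0 d'S ->; rewrite map_f.
  by rewrite mem_lists sc' eqxx; apply/allP => d' /mem_take/yS0.
have selE w : w \in words k (size x) -> take m w = iota 0 m ->
    map (back c') y @ w = map (back (take m (y @ w))) (y @ w).
  move=> wx wm; rewrite -(map_sel d0) -?sxy ?(words_all wx) //.
  by rewrite take_sel wm sel_iota ?drop0 // -sxy.
rewrite !selE //; apply: (homy (x @ u)); rewrite ?size_sel ?(size_words ux) //.
by apply: (map_f (fun u => x @ u)).
Qed.

End Ramsey.

(** * Behaviours of canonical functions *)

Lemma uniq_lists (T : eqType) (Q : seq T) n : uniq Q -> uniq (lists Q n).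
Proof.
move=> uQ; elim: n => // n IH; rewrite /lists iterS -/(lists Q n).
by apply: allpairs_uniq => // -[x l] [x' l'] _ _ /= [-> ->].
Qed.

Lemma uniq_words n N : uniq (words n N).
Proof. by apply: uniq_lists; exact: iota_uniq. Qed.

(** The [n]-types over the colours are lists indexed by [words b n]. *)
Definition lookup b n (P : seq nat) w := nth 0 P (index w (words b n)).

Definition reindex b n (P rho : seq nat) :=
  [seq lookup b n P (sel 0 rho w) | w <- words b n].

Lemma lookup_map b n (f : seq nat -> nat) w : w \in words b n ->
  lookup b n [seq f v | v <- words b n] w = f w.
Proof.
by move=> wn; rewrite /lookup (nth_map [::]) ?index_mem // nth_index.
Qed.

Lemma map_lookup b n P : size P = size (words b n) ->
  [seq lookup b n P w | w <- words b n] = P.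
Proof.
move=> sP; apply: (@eq_from_nth _ 0); rewrite size_map // => i iw.
by rewrite (nth_map [::]) // /lookup index_uniq // uniq_words.
Qed.

Section Types.
Variables (tau : signature) (D : choiceType) (d0 : D) (Delta : structure tau D).
Variable b : nat.
Hypothesis b_gt2 : 2 < b.
Hypothesis b_ar : forall s : tau, (ar s).*2 <= b.
Variables (m : nat) (F : 'I_m -> fin_structure tau).
Hypothesis F_bounds : forall A : fin_structure tau,
  age Delta A <-> forall i, ~ embeds (F i) (@rels _ A).
Hypothesis b_F : forall i, #|F i| <= b.
Implicit Types (x y z : seq D).

Local Notation "x @ u" := (sel d0 x u) (at level 20).
Local Notation same_type := (same_type d0 Delta).
Local Notation colour := (colour d0 Delta b).

(** The type of an [n]-tuple as a finite object: the colours of its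
[b]-subtuples. *)
Definition tp n z := [seq colour (z @ w) | w <- words b n].

Lemma lookup_tp n z w : w \in words b n -> lookup b n (tp n z) w = colour (z @ w).
Proof. exact: lookup_map. Qed.

Lemma tp_eq n z z' : size z = n -> size z' = n ->
  (tp n z = tp n z' <-> same_type z z').
Proof.
move=> sz sz'; rewrite (same_typeP d0 Delta b_gt2 b_ar) sz sz'.
by split=> [/eq_in_map//|[_]/eq_in_map].
Qed.

Lemma tp_reindex n z rho : size z = n -> rho \in words n n ->
  tp n (z @ rho) = reindex b n (tp n z) rho.
Proof.
move=> sz rn; apply/eq_in_map => w wn.
rewrite lookup_tp; last exact: sel_words rn wn.
by rewrite -sel_sel // (size_words rn) (words_all wn).
Qed.

Definition compatible (Q : seq nat) (ac : nat -> seq nat -> nat) n P :=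
  all (fun w => (lookup b n P w \in Q) &&
    all (fun f => lookup b n P (sel 0 w f) == ac (lookup b n P w) f) (words b b))
    (words b n).

Definition types n :=
  [seq P <- lists (colours d0 Delta b) (size (words b n))
  | compatible (colours d0 Delta b) (act d0 Delta b) n P].

(** The list [types n] is computed from the finite table [act] alone;
[realization] shows that it contains nothing but types of tuples of [D]. *)
Lemma mem_types n P : P \in types n <-> exists2 z, size z = n & tp n z = P.
Proof.
rewrite mem_filter mem_lists; split=> [/and3P[/allP comp /eqP sP _]|[z sz <-]].
  have [|w f wn fb|x sx xP] := @realization _ D d0 Delta b m F
    b_gt2 b_ar F_bounds b_F n (lookup b n P).
  - by move=> w /comp/andP[].
  - by have /andP[_ /allP/(_ f fb)/eqP] := comp w wn.
  exists x => //; rewrite -[RHS](map_lookup sP); exact/eq_in_map.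
have colz w : w \in words b n -> colour (z @ w) \in colours d0 Delta b.
  by move=> wn; apply: colour_in; rewrite size_sel (size_words wn).
apply/and3P; split; last first.
- by apply/allP => _ /mapP[w wn ->]; exact: colz.
- by rewrite size_map.
apply/allP => w wn; rewrite lookup_tp // colz //=.
apply/allP => f fb; rewrite lookup_tp ?(sel_words wn) //.
rewrite sel_sel ?(size_words wn) ?(words_all fb) //.
by rewrite colour_sel // size_sel (size_words wn).
Qed.

Lemma tp_types n z : size z = n -> tp n z \in types n.
Proof. by move=> sz; apply/mem_types; exists z. Qed.

End Types.

Section Behaviours.
Variables (tau : signature) (D : choiceType) (d0 : D) (Delta : structure tau D).
Hypothesis Delta_ordered : ordered (age Delta).
Hypothesis Delta_homogeneous : homogeneous Delta.
Hypothesis Delta_ramsey : ramsey (age Delta).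
Variable b : nat.
Hypothesis b_gt2 : 2 < b.
Hypothesis b_ar : forall s : tau, (ar s).*2 <= b.
Variables (nF : nat) (F : 'I_nF -> fin_structure tau).
Hypothesis F_bounds : forall A : fin_structure tau,
  age Delta A <-> forall i, ~ embeds (F i) (@rels _ A).
Hypothesis b_F : forall i, #|F i| <= b.
Implicit Types (x y z t s : seq D) (P p : seq nat).

Local Notation "x @ u" := (sel d0 x u) (at level 20).
Local Notation same_type := (same_type d0 Delta).
Local Notation colour := (colour d0 Delta b).
Local Notation tp := (tp d0 Delta b).
Local Notation types := (types d0 Delta b).

(** By homogeneity, invariance under the automorphisms of [Delta]. *)
Definition type_invariant n (R : seq D -> Prop) :=
  forall z z', size z = n -> same_type z z' -> R z -> R z'.

Variables (I : Type) (r : I -> nat) (R : I -> seq D -> Prop).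
Hypothesis R_inv : forall i, type_invariant (r i) (R i).
Variable ieq : I.
Hypothesis r_ieq : r ieq = 2.
Hypothesis R_ieq : forall z, R ieq z <-> nth d0 z 0 = nth d0 z 1.
Variables (m : nat) (R0 : seq D -> Prop).
Hypothesis R0_inv : type_invariant m R0.

Definition hom x y :=
  forall i a, a \in words (r i) (size x) -> R i (x @ a) -> R i (y @ a).

(** Partial homomorphisms on all finite sets take the place of an endomorphism
that sends [t] to [s]. *)
Definition moves t s :=
  forall x, exists2 y, size y = size x & hom (t ++ x) (s ++ y).

Definition separated := exists t s,
  [/\ size t = m, size s = m, R0 t, ~ R0 s & moves t s].

Variable k : nat.
Hypothesis b_k : b <= k.
Hypothesis r_k : forall i, r i <= k.
Let K := m + k.

Definition rel_at (Q : seq D -> Prop) P a :=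
  exists z, [/\ size z = K, tp K z = P & Q (z @ a)].

Lemma rel_at_tp n Q z a : type_invariant n Q -> size z = K -> a \in words n K ->
  rel_at Q (tp K z) a <-> Q (z @ a).
Proof.
move=> inv sz aK; split=> [[z' [sz' /(tp_eq d0 Delta b_gt2 b_ar sz' sz) ezz']]|Qz];
  last by exists z.
apply: (inv (z' @ a)); first by rewrite size_sel (size_words aK).
by apply: (same_type_sel (n := n)) => //; rewrite sz'.
Qed.

Definition same_start p p' :=
  {in words b m, forall w, lookup b K p w = lookup b K p' w}.

(** [B] is the behaviour of a function that is canonical over the parameters
held by the first [m] coordinates: the type of a tuple that starts with the
parameters determines the type of its image.  [p0] fixes the type of the
parameters. *)
Definition certificate (B : seq nat -> seq nat) p0 :=
  [/\ p0 \in types K, {in types K, forall p, B p \in types K},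
      rel_at R0 p0 (iota 0 m), ~ rel_at R0 (B p0) (iota 0 m) &
      {in types K, forall p, same_start p0 p ->
        [/\ same_start (B p0) (B p),
            {in words K K, forall rho, take m rho = iota 0 m ->
              B (reindex b K p rho) = reindex b K (B p) rho}
          & forall i, rel_at (R i) p (iota m (r i)) ->
              rel_at (R i) (B p) (iota m (r i))]}].

Let m_K : m <= K. Proof. exact: leq_addr. Qed.

Let words_mK n w : w \in words n m -> w \in words n K.
Proof. exact: words_widen. Qed.

Lemma same_startP z z' : size z = K -> size z' = K ->
  same_start (tp K z) (tp K z') <-> same_type (take m z) (take m z').
Proof.
move=> sz sz'.
have tE y w : size y = K -> w \in words b m -> colour (y @ w) = colour (take m y @ w).
  move=> sy wm; congr colour; rewrite -{1}(cat_take_drop m y) sel_catl //.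
  by rewrite size_takel ?sy // (words_all wm).
rewrite (same_typeP d0 Delta b_gt2 b_ar) !size_takel ?sz ?sz' //.
split=> [st|[_ st] w wm].
  split=> // w wm; rewrite -!tE //.
  by have := st w wm; rewrite !lookup_tp // words_mK.
by rewrite !lookup_tp ?words_mK // (tE z) // (tE z') // st.
Qed.

Lemma iota0_words : iota 0 m \in words m K.
Proof. exact: iota_words. Qed.

Lemma iotar_words i : iota m (r i) \in words (r i) K.
Proof. by apply: iota_words; rewrite leq_add2l. Qed.

Section FromCertificate.
Variables (B : seq nat -> seq nat) (p0 : seq nat).
Hypothesis B_cert : certificate B p0.
Variable (X : seq D).
Hypothesis X_gt0 : 0 < size X.
Hypothesis X_start : m <= size X.
Let N := size X.
Hypothesis X_p0 : forall z, tp K z = p0 -> size z = K ->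
  same_type (take m z) (take m X).

(* The parameters followed by the entries of [w], the last one being repeated;
as a reindexing it fixes the parameters. *)
Let spread w := iota 0 m ++ [seq nth 0 w (minn j b.-1) | j <- iota 0 k].

Let b_gt0 : 0 < b. Proof. by lia. Qed.

Let spread_words w M : m <= M -> w \in words b M -> spread w \in words K M.
Proof.
move=> mM wM; apply: cat_words; first exact: iota_words.
rewrite mem_words size_map size_iota eqxx; apply/allP => _ /mapP[j _ ->].
by apply: (words_lt wM); lia.
Qed.

Let take_spread w : take m (spread w) = iota 0 m.
Proof. by rewrite take_size_cat ?size_iota. Qed.

Let sel_spread u w n : u \in words K n -> w \in words b K -> take m u = iota 0 m ->
  sel 0 u (spread w) = spread (sel 0 u w).
Proof.
move=> uK wK um; rewrite /spread sel_cat sel_iota ?(size_words uK) // drop0 um.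
congr cat; rewrite /sel -map_comp; apply: eq_map => j /=.
by rewrite (nth_map 0) // (size_words wK); lia.
Qed.

Let spread_shift w : size w = b -> sel 0 (spread w) (iota m b) = w.
Proof.
move=> sw; rewrite sel_iota; last by rewrite size_cat size_map !size_iota leq_add2l.
rewrite drop_size_cat ?size_iota //.
apply: (@eq_from_nth _ 0); first by rewrite size_takel ?sw // size_map size_iota.
move=> j; rewrite size_takel ?size_map ?size_iota // => jb.
rewrite nth_take // (nth_map 0) ?size_iota; last by lia.
by rewrite nth_iota; [congr nth; lia|lia].
Qed.

Let shift_words : iota m b \in words b K.
Proof. by apply: iota_words; rewrite leq_add2l. Qed.

(* The colour that [B] prescribes for the image of the tuple [X @ w]. *)
Let T w := lookup b K (B (tp K (X @ spread w))) (iota m b).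

Let tpX u : u \in words K N -> tp K (X @ u) \in types K.
Proof. by move=> uN; apply: tp_types => //; rewrite size_sel (size_words uN). Qed.

Let startX u : u \in words K N -> take m u = iota 0 m ->
  same_start p0 (tp K (X @ u)).
Proof.
move=> uN um; have [p0W _ _ _ _] := B_cert.
have /(mem_types d0 b_gt2 b_ar F_bounds b_F)[z0 sz0 tz0] := p0W.
rewrite -tz0; apply/same_startP => //; first by rewrite size_sel (size_words uN).
by rewrite take_sel um sel_iota // drop0; exact: X_p0.
Qed.

(* Invariance of [B] under reindexing makes the prescription for [X @ w]
independent of the longer tuple from which it is read. *)
Let T_sel u w : u \in words K N -> take m u = iota 0 m -> w \in words b K ->
  T (sel 0 u w) = lookup b K (B (tp K (X @ u))) w.
Proof.
move=> uN um wK; have [_ _ _ _ cert] := B_cert.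
have [_ Brho _] := cert _ (tpX uN) (startX uN um).
have swK := spread_words m_K wK.
rewrite /T -(sel_spread uN) // sel_sel ?(size_words uN) ?(words_all swK) //.
rewrite tp_reindex ?size_sel ?(size_words uN) //.
rewrite Brho // /reindex lookup_map //.
by rewrite spread_shift // (size_words wK).
Qed.

Let T_colour : {in words b N, forall w, T w \in colours d0 Delta b}.
Proof.
move=> w wN; have [_ BW _ _ _] := B_cert.
have := BW _ (tpX (spread_words X_start wN)).
move=> /(mem_types d0 b_gt2 b_ar F_bounds b_F)[z sz tz].
rewrite /T -tz lookup_tp //; apply: colour_in.
by rewrite size_sel size_iota.
Qed.

Let T_act : {in words b N & words b b,
  forall w f, T (sel 0 w f) = act d0 Delta b (T w) f}.
Proof.
move=> w f wN fb; have [_ BW _ _ _] := B_cert.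
have swN := spread_words X_start wN.
have -> : sel 0 w f = sel 0 (spread w) (sel 0 (iota m b) f).
  by rewrite sel_sel ?size_iota ?(words_all fb) // spread_shift // (size_words wN).
rewrite T_sel //; last exact: sel_words shift_words fb.
have := BW _ (tpX swN).
move=> /(mem_types d0 b_gt2 b_ar F_bounds b_F)[z sz tz].
rewrite /T -tz !lookup_tp //; last exact: sel_words shift_words fb.
rewrite sel_sel ?size_iota ?(words_all fb) // colour_sel //.
by rewrite size_sel size_iota.
Qed.

(** The colours prescribed by [B] fit together, so [realization] provides a
tuple [Z]; every [K]-subtuple of [Z] that starts with the parameters has the
type given by [B], and [B] preserves the relations. *)
Lemma behaviour_image : exists2 Z, size Z = N &
  hom X Z /\ forall z, tp K z = B p0 -> size z = K -> same_type (take m z) (take m Z).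
Proof.
have [_ BW _ _ cert] := B_cert.
have [Z sZ ZT] := @realization _ D d0 Delta b nF F b_gt2 b_ar F_bounds b_F
  N T T_colour T_act.
have tpZ u : u \in words K N -> take m u = iota 0 m ->
    tp K (Z @ u) = B (tp K (X @ u)).
  move=> uN um.
  have /(mem_types d0 b_gt2 b_ar F_bounds b_F)[z sz tz] := BW _ (tpX uN).
  rewrite -tz; apply/eq_in_map => w wK.
  rewrite -sel_sel ?(size_words uN) ?(words_all wK) // ZT;
    last exact: sel_words uN wK.
  by rewrite T_sel // -tz lookup_tp.
exists Z => //; split=> [i a aN Ria|z tz sz].
  pose u := (iota 0 m ++ a) ++ nseq (k - r i) 0.
  have uN : u \in words K N.
    have -> : K = (m + r i) + (k - r i) by rewrite -addnA subnKC.
    apply: cat_words (nseq_words _ X_gt0); apply: cat_words aN.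
    exact: iota_words.
  have um : take m u = iota 0 m by rewrite /u -catA take_size_cat ?size_iota.
  have ua : sel 0 u (iota m (r i)) = a.
    rewrite sel_iota; last by rewrite (size_words uN) leq_add2l.
    rewrite /u -catA drop_size_cat ?size_iota //.
    by rewrite take_size_cat // (size_words aN).
  have [_ _ /(_ i)] := cert _ (tpX uN) (startX uN um).
  rewrite -tpZ // !(rel_at_tp (R_inv (i := i))) ?size_sel ?(size_words uN)
    ?iotar_words //.
  by rewrite -!sel_sel ?(size_words uN) ?(words_all (iotar_words i)) // ua; apply.
pose u := spread (nseq b 0).
have uN : u \in words K N by apply: spread_words => //; exact: nseq_words.
have [st _ _] := cert _ (tpX uN) (startX uN (take_spread _)).
move: st; rewrite -(tpZ u uN (take_spread _)) -tz same_startP ?size_sel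
  ?(size_words uN) //.
by rewrite take_sel take_spread sel_iota ?drop0 // sZ.
Qed.

End FromCertificate.

Lemma certificate_separated B p0 : certificate B p0 -> separated.
Proof.
move=> cert; have [p0W BW R0p nR0p _] := cert.
have /(mem_types d0 b_gt2 b_ar F_bounds b_F)[z0 sz0 tz0] := p0W.
have /(mem_types d0 b_gt2 b_ar F_bounds b_F)[z1 sz1 tz1] := BW _ p0W.
exists (take m z0), (take m z1); split; rewrite ?size_takel ?sz0 ?sz1 //.
- move: R0p; rewrite -tz0 (rel_at_tp R0_inv) ?iota0_words //.
  by rewrite sel_iota ?sz0 // drop0.
- move: nR0p; rewrite -tz1 (rel_at_tp R0_inv) ?iota0_words //.
  by rewrite sel_iota ?sz1 // drop0.
move=> x; pose X := take m z0 ++ x.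
have sX : size X = m + size x by rewrite size_cat size_takel // sz0.
have [X0|X_gt0] := posnP (size X).
  have /andP[/eqP m0 /eqP x0] : (m == 0) && (size x == 0) by rewrite -addn_eq0 -sX X0.
  exists x => // i a; rewrite -/X X0 => ax.
  by rewrite (size0nil X0) m0 take0 /= (size0nil x0).
have [||Z sZ [XZ Zp]] := behaviour_image cert X_gt0.
- by rewrite sX leq_addr.
- move=> z tz sz; rewrite take_size_cat; last by rewrite size_takel ?sz0.
  have : same_type z z0 by apply/(tp_eq d0 Delta b_gt2 b_ar sz sz0); rewrite tz.
  rewrite -[X in same_type X _ -> _](sel_id d0) => ezz0.
  have -> : take m z = z @ iota 0 m by rewrite sel_iota ?drop0 ?sz.
  have -> : take m z0 = z0 @ iota 0 m by rewrite sel_iota ?drop0 ?sz0.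
  by apply: (same_type_sel (n := m));
    [rewrite sel_id in ezz0 | rewrite sz iota0_words].
have [g gaut gZ] := same_type_automorphism Delta_homogeneous (same_type_sym (Zp _
  tz1 sz1)).
exists (map g (drop m Z)); first by rewrite size_map size_drop sZ sX addKn.
rewrite -gZ -map_cat cat_take_drop => i a aX Ra.
have := XZ i a aX Ra; rewrite -(map_sel d0) ?sZ ?(words_all aX) //.
apply: R_inv; first by rewrite size_sel (size_words aX).
exact: automorphism_same_type.
Qed.

(** Equality is one of the preserved relations, so the partial homomorphism is a
function on its domain. *)
Lemma moves_map t s : moves t s -> size t = size s -> forall S : seq D,
  exists h : D -> D, map h t = s /\
    forall i z, size z = r i -> {subset z <= t ++ S} -> R i z -> R i (map h z).
Proof.
move=> mv sts S; have [yS syS tS_hom] := mv S.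
pose X := t ++ S; pose Z := s ++ yS.
have sXZ : size X = size Z by rewrite !size_cat sts syS.
pose h d := nth d0 Z (index d X).
have hE j : j < size X -> h (nth d0 X j) = nth d0 Z j.
  move=> jX; rewrite /h; set j' := index _ _.
  have j'X : j' < size X by rewrite index_mem mem_nth.
  have w2 : [:: j'; j] \in words (r ieq) (size X) by rewrite r_ieq mem_words /= j'X
    jX.
  have := tS_hom ieq _ w2; rewrite !R_ieq /=; apply.
  by rewrite nth_index // mem_nth.
have hX : map h X = Z.
  apply: (@eq_from_nth _ d0); rewrite size_map // => j jX.
  by rewrite (nth_map d0) // hE.
exists h; split=> [|i z sz zX Rz].
  have := congr1 (take (size t)) hX.
  by rewrite -map_take !take_size_cat.
have zw := pos_words zX; rewrite sz in zw.
rewrite -(sel_pos d0 zX) (map_sel d0 d0) ?(words_all zw) // hX.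
by apply: tS_hom => //; rewrite sel_pos.
Qed.

(** Canonization: colour a tuple by the type of its image under a partial
homomorphism [h] that sends [t] to [s].  By [ramsey_constants] there is a copy
of a tuple realizing all types over [t] on which this colour depends on the
type of the tuple alone; that dependence is the behaviour [B]. *)
Lemma separated_certificate : separated -> exists B p0, certificate B p0.
Proof.
move=> [t [s [st ss R0t nR0s mv]]].
pose W := types K.
pose rz p : seq D :=
  if pselect (exists z, [/\ size z = K, tp K z = p & take m z = t]) is left e
  then sval (cid e) else [::].
(* Every [K]-type over [t] is the type of a subtuple of [x]. *)
pose x := t ++ flatten [seq rz p | p <- W].
have tx : take (size t) x = t by rewrite take_size_cat.
have mx : m <= size x by rewrite size_cat st leq_addr.
have [S HS] := ramsey_constants d0 Delta_ordered Delta_homogeneous Delta_ramsey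
  (size W) K tx.
have [h [ht hR]] := moves_map mv (etrans st (esym ss)) S.
pose G z : 'I_(size W).+1 := inord (index (tp K (map h z)) W).
have GE z z' : size z = K -> size z' = K -> G z = G z' ->
    tp K (map h z) = tp K (map h z').
  move=> sz sz' /(congr1 (@nat_of_ord _));
    rewrite /G !inordK ?ltnS ?index_size // => e.
  have zW : tp K (map h z) \in W by apply: tp_types; rewrite // size_map.
  have z'W : tp K (map h z') \in W by apply: tp_types; rewrite // size_map.
  by rewrite -(nth_index [::] zW) e nth_index.
have [y [exy ty yS homy]] := HS G; rewrite st in ty homy.
have [sxy _ _] := exy.
(* The choice of [u] is immaterial by homogeneity of [y]; see [BE]. *)
pose B p := if pselect (exists u, [/\ u \in words K (size x),
    take m u = iota 0 m & tp K (x @ u) = p]) is left e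
  then tp K (map h (y @ sval (cid e))) else p.
have sxu u : u \in words K (size x) -> size (x @ u) = K.
  by move=> ux; rewrite size_sel (size_words ux).
have syu u : u \in words K (size x) -> size (y @ u) = K.
  by move=> ux; rewrite size_sel (size_words ux).
have BE u : u \in words K (size x) -> take m u = iota 0 m ->
    B (tp K (x @ u)) = tp K (map h (y @ u)).
  move=> ux um; rewrite /B; case: pselect => [e|[]]; last by exists u.
  case: (cid e) => u' [u'x u'm tu'] /=; apply: GE; rewrite ?syu //.
  by apply: homy => //; apply/(tp_eq d0 Delta b_gt2 b_ar _ _); rewrite ?sxu.
pose z0 := t ++ nseq k d0.
have sz0 : size z0 = K by rewrite size_cat st size_nseq.
have good p : p \in W -> same_start (tp K z0) p -> exists2 u,
    u \in words K (size x) & take m u = iota 0 m /\ tp K (x @ u) = p.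
  move=> pW.
  have /(mem_types d0 b_gt2 b_ar F_bounds b_F)[z sz tz] := pW.
  rewrite -tz same_startP // take_size_cat // => etz.
  have [g gaut gt] := same_type_automorphism Delta_homogeneous (same_type_sym etz).
  have ex : exists z, [/\ size z = K, tp K z = p & take m z = t].
    exists (map g z); rewrite size_map -map_take; split=> //.
    rewrite -tz; apply/(tp_eq d0 Delta b_gt2 b_ar _ _); rewrite ?size_map //.
    by apply: same_type_sym; exact: automorphism_same_type.
  have [srz trz mrz] : [/\ size (rz p) = K, tp K (rz p) = p & take m (rz p) = t].
    by rewrite /rz; case: pselect => // e; case: (cid e).
  have sub : {subset drop m (rz p) <= x}.
    move=> d /mem_drop dr; rewrite mem_cat; apply/orP; right.
    by apply/flatten_mapP; exists p.
  exists (iota 0 m ++ pos x (drop m (rz p))).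
    have -> : K = m + size (drop m (rz p)) by rewrite size_drop srz addKn.
    apply: cat_words (pos_words sub); exact: iota_words.
  split; first by rewrite take_size_cat ?size_iota.
  by rewrite sel_cat sel_pos // sel_iota // drop0 -{1}st tx -mrz cat_take_drop trz.
have startE p q : (exists2 u, u \in words K (size x) & take m u = iota 0 m /\ tp K
  (map h (y @ u)) = p) ->
  (exists2 u, u \in words K (size x) & take m u = iota 0 m /\ tp K (map h (y @ u))
    = q) ->
  same_start p q.
  move=> [u ux [um <-]] [v vx [vm <-]]; apply/same_startP;
    rewrite ?size_map ?size_sel ?(size_words ux) ?(size_words vx) //.
  by rewrite -!map_take ?take_sel um vm; exact: same_type_refl.
have p0W : tp K z0 \in W by exact: tp_types.
have [u0 u0x [u0m tu0]] := good _ p0W (fun _ _ => erefl).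
have hys u : u \in words K (size x) -> take m u = iota 0 m ->
    map h (y @ u) @ iota 0 m = s.
  move=> ux um; rewrite sel_iota0 ?size_map ?size_sel ?(size_words ux) //.
  by rewrite -map_take take_sel um sel_iota0 ?ty // -sxy.
exists B, (tp K z0); split=> //.
- move=> p pW; rewrite /B; case: pselect => // e; case: (cid e) => u [ux _ _] /=.
  by apply: tp_types; rewrite // size_map syu.
- apply/(rel_at_tp R0_inv) => //; first exact: iota0_words.
  by rewrite sel_iota ?sz0 // drop0 take_size_cat.
- rewrite -tu0 BE // (rel_at_tp R0_inv) ?size_map ?(size_words u0x) ?iota0_words //.
  by rewrite hys.
move=> p pW /(good _ pW)[u ux [um tu]]; split.
- apply: startE; first by exists u0 => //; split=> //; rewrite -BE // tu0.
  by exists u => //; split=> //; rewrite -BE // tu.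
- move=> rho rK rm; rewrite -tu -tp_reindex ?sxu // -sel_sel ?(size_words ux)
  ?(words_all rK) //.
  rewrite BE ?(sel_words ux rK) //; last first.
    by rewrite take_sel rm sel_iota ?(size_words ux) // drop0.
  rewrite BE // -tp_reindex ?size_map ?(size_words ux) //.
  rewrite sel_sel ?(size_words ux) ?(words_all rK) // (map_sel d0 d0) //.
  by rewrite syu // (words_all rK).
- move=> i; rewrite -tu BE // !(rel_at_tp (R_inv (i := i))) ?size_map ?size_sel
  ?(size_words ux) ?iotar_words //.
  have iK := iotar_words i; have siK := size_words iK.
  rewrite -(map_sel d0) ?syu ?(words_all iK) // => Rx.
  apply: hR; first by rewrite size_sel.
    move=> d; rewrite mem_cat => dy; apply/orP; right; apply: yS.
    have uy : u \in words K (size y) by rewrite -sxy.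
    have iy : iota m (r i) \in words (r i) (size (y @ u)) by rewrite syu.
    exact: (mem_sel uy (mem_sel iy dy)).
  apply: R_inv Rx; first by rewrite size_sel.
  by apply: (same_type_sel (n := r i)); rewrite ?sxu //;
    exact: (same_type_sel exy ux).
Qed.

End Behaviours.

(** * Definability and partial homomorphisms *)

Section Hom.
Variables (D : choiceType) (d0 : D).
Variables (I : Type) (r : I -> nat) (R : I -> seq D -> Prop).
Local Notation "x @ u" := (sel d0 x u) (at level 20).
Local Notation hom := (hom d0 r R).

Lemma hom_sel n x y u : size x = size y -> hom x y -> u \in words n (size x) ->
  hom (x @ u) (y @ u).
Proof.
move=> sxy xy ux i a; rewrite size_sel => ax.
have su : a \in words (r i) n by rewrite -(size_words ux).
rewrite -!sel_sel ?(words_all ax) //; apply: xy.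
exact: sel_words ux su.
Qed.

Lemma hom_swap x y x' y' : size x = size x' -> size y = size y' ->
  hom (x ++ y) (x' ++ y') -> hom (y ++ x) (y' ++ x').
Proof.
move=> sx sy xy.
pose u := iota (size x) (size y) ++ iota 0 (size x).
have swap (z z' : seq D) : size z = size x -> size z' = size y ->
    (z ++ z') @ u = z' ++ z.
  move=> sz sz'; rewrite sel_cat !sel_iota ?size_cat ?sz ?sz' ?leq_addr //.
  by rewrite drop0 take_size_cat // drop_size_cat // -sz' take_size.
rewrite -(swap x y) // -(swap x' y') //.
apply: (@hom_sel (size y + size x)) xy _.
  by rewrite !size_cat sx sy.
by apply: cat_words; apply: iota_words; rewrite size_cat ?leq_addr.
Qed.
End Hom.

Section Formulas.
Variables (sg : signature) (T : Type) (M : structure sg T).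

Lemma qf_existential n (p : formula sg n) : quantifier_free p -> existential p.
Proof. by case: p. Qed.

(** Without negation, truth is no quantifier-free formula when there are no
variables, so the empty conjunction [p0] is a parameter. *)
Definition conj_all n (p0 : formula sg n) ps := foldr (@FAnd sg n) p0 ps.
Definition disj_all n ps := foldr (@FOr sg n) (FFalse sg n) ps.

Lemma quantifier_free_conj n (p0 : formula sg n) ps :
  quantifier_free (conj_all p0 ps) = quantifier_free p0 && all (@quantifier_free sg
    n) ps.
Proof. by elim: ps => [|p ps IH] /=; rewrite ?andbT // IH andbCA. Qed.

Lemma negation_free_conj n (p0 : formula sg n) ps :
  negation_free (conj_all p0 ps) = negation_free p0 && all (@negation_free sg n) ps.
Proof. by elim: ps => [|p ps IH] /=; rewrite ?andbT // IH andbCA. Qed.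

Lemma quantifier_free_disj n (ps : seq (formula sg n)) :
  quantifier_free (disj_all ps) = all (@quantifier_free sg n) ps.
Proof. by elim: ps => //= p ps ->. Qed.

Lemma negation_free_disj n (ps : seq (formula sg n)) :
  negation_free (disj_all ps) = all (@negation_free sg n) ps.
Proof. by elim: ps => //= p ps ->. Qed.

(** Membership in a list of formulas would require decidable equality of
formulas; the index [j] avoids this. *)
Lemma sat_conj (J : eqType) n (p0 : formula sg n) (f : J -> formula sg n)
    (js : seq J) e :
  sat M (conj_all p0 (map f js)) e <-> sat M p0 e /\ {in js, forall j, sat M (f j) e}.
Proof.
elim: js => [|j js IH] /=; first by split=> [|[]].
rewrite IH; split=> [[fj [sp0 fjs]]|[sp0 fjs]].
  by split=> // j'; rewrite inE => /orP[/eqP->//|]; exact: fjs.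
split; first by apply: fjs; rewrite inE eqxx.
by split=> // j' j'js; apply: fjs; rewrite inE j'js orbT.
Qed.

Lemma sat_disj (J : eqType) n (f : J -> formula sg n) (js : seq J) e :
  sat M (disj_all (map f js)) e <-> exists2 j, j \in js & sat M (f j) e.
Proof.
elim: js => [|j js IH] /=; first by split=> // -[].
rewrite IH; split=> [[fj|[j' j'js fj']]|[j']].
- by exists j; rewrite // inE eqxx.
- by exists j'; rewrite // inE j'js orbT.
by rewrite inE => /orP[/eqP->|j'js] fj'; [left|right; exists j'].
Qed.

Fixpoint exists_n n m : formula sg (n + m) -> formula sg m :=
  match n return formula sg (n + m) -> formula sg m with
  | 0 => id
  | n.+1 => fun p => exists_n (FEx p)
  end.

Lemma sat_exists_n n m (p : formula sg (n + m)) (e : m.-tuple T) :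
  sat M (exists_n p) e <-> exists ys : n.-tuple T, sat M p [tuple of ys ++ e].
Proof.
elim: n p => [|n IH] p /=.
  split=> [h|[ys]]; first by exists [tuple]; congr sat: h; apply: val_inj.
  by congr sat; apply: val_inj; rewrite /= (tuple0 ys).
rewrite IH; split=> [[ys /= [x h]]|[ys h]].
  by exists [tuple of x :: ys]; congr sat: h; apply: val_inj.
exists [tuple of behead ys], (thead ys).
by congr sat: h; apply: val_inj => /=; rewrite {1}(tuple_eta ys).
Qed.

Lemma existential_exists_n n m (p : formula sg (n + m)) :
  existential p -> existential (exists_n p).
Proof. by elim: n p => [|n IH] p //= ep; apply: IH. Qed.

Lemma negation_free_exists_n n m (p : formula sg (n + m)) :
  negation_free p -> negation_free (exists_n p).
Proof. by elim: n p => [|n IH] p //= ep; apply: IH. Qed.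

Definition atomic n (p : formula sg n) :=
  match p with FEq _ _ _ | FRel _ _ _ => true | _ => false end.

Lemma qf_sat_mono n (p : formula sg n) (e e' : n.-tuple T) :
  (forall q : formula sg n, atomic q -> sat M q e -> sat M q e') ->
  quantifier_free p -> negation_free p -> sat M p e -> sat M p e'.
Proof.
elim: p e e' => {n}[n|n i j|n s v|n p IH|n p IHp q IHq|n p IHp q IHq|n p IH|n p IH]
  //= e e' atP.
- by move=> _ _; exact: (atP (FEq _ i j)).
- by move=> _ _; exact: (atP (FRel v)).
- by move=> /andP[? ?] /andP[? ?] [? ?]; split;
  [apply: IHp atP _ _ _|apply: IHq atP _ _ _].
- move=> /andP[? ?] /andP[? ?] [?|?]; [left; exact: IHp atP _ _ _|right;
  exact: IHq atP _ _ _].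
Qed.

Lemma qf_sat_iff n (p : formula sg n) (e e' : n.-tuple T) :
  (forall q : formula sg n, atomic q -> sat M q e <-> sat M q e') ->
  quantifier_free p -> sat M p e <-> sat M p e'.
Proof.
elim: p e e' => {n}[n|n i j|n s v|n p IH|n p IHp q IHq|n p IHp q IHq|n p IH|n p IH]
  //= e e' atP.
- by move=> _; exact: (atP (FEq _ i j)).
- by move=> _; exact: (atP (FRel v)).
- by move=> qf; rewrite (IH _ _ atP qf).
- by move=> /andP[qp qq]; rewrite (IHp _ _ atP qp) (IHq _ _ atP qq).
- by move=> /andP[qp qq]; rewrite (IHp _ _ atP qp) (IHq _ _ atP qq).
Qed.

Lemma sat_automorphism n (p : formula sg n) (e : n.-tuple T) (g : T -> T) :
  isomorphism M M g -> sat M p e <-> sat M p (map_tuple g e).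
Proof.
move=> [gbij gpres]; have [h gK hK] := gbij.
elim: p e => {n}[n|n i j|n s v|n p IH|n p IHp q IHq|n p IHp q IHq|n p IH|n p IH]
  //= e.
- rewrite !tnth_map; split=> [->//|]; exact: bij_inj.
- rewrite gpres; set t := map_tuple _ _; set t' := map_tuple _ _.
  by suff -> : t = t' by []; apply: eq_from_tnth => i; rewrite !tnth_map.
- by rewrite IH.
- by rewrite IHp IHq.
- by rewrite IHp IHq.
- have gE x : map_tuple g [tuple of x :: e] = [tuple of g x :: map_tuple g e].
    exact: val_inj.
  split=> -[x]; first by rewrite IH gE; exists (g x).
  by exists (h x); rewrite IH gE hK.
have gE x : map_tuple g [tuple of x :: e] = [tuple of g x :: map_tuple g e].
  exact: val_inj.
split=> sx x; last by rewrite IH gE.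
by have := sx (h x); rewrite IH gE hK.
Qed.

End Formulas.

Section Definability.
Variables (tau : signature) (D : choiceType) (d0 : D) (Delta : structure tau D).
Hypothesis Delta_homogeneous : homogeneous Delta.
Variable b : nat.
Hypothesis b_gt2 : 2 < b.
Hypothesis b_ar : forall s : tau, (ar s).*2 <= b.
Variables (nF : nat) (F : 'I_nF -> fin_structure tau).
Hypothesis F_bounds : forall A : fin_structure tau,
  age Delta A <-> forall i, ~ embeds (F i) (@rels _ A).
Hypothesis b_F : forall i, #|F i| <= b.
Variables (sg : signature) (M : structure sg D).
Variables (I : finType) (r : I -> nat) (R : I -> seq D -> Prop).
Hypothesis R_inv : forall i, type_invariant d0 Delta (r i) (R i).
Variable lit : forall n (i : I), (r i).-tuple 'I_n -> formula sg n.
Hypothesis lit_qf : forall n i a, quantifier_free (@lit n i a).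
Hypothesis sat_lit : forall n i (a : (r i).-tuple 'I_n) (e : n.-tuple D),
  sat M (lit a) e <-> R i (sel d0 e (map val a)).
(* Negation is excluded when [positive] holds. *)
Variable positive : bool.
Hypothesis lit_pos : positive -> forall n i a, negation_free (@lit n i a).
Variables (m : nat) (R0 : seq D -> Prop).
Hypothesis R0_inv : type_invariant d0 Delta m R0.
Implicit Types (x y z s t : seq D).

Local Notation "x @ u" := (sel d0 x u) (at level 20).
Local Notation same_type := (same_type d0 Delta).
Local Notation hom := (hom d0 r R).
Local Notation moves := (moves d0 r R).
Local Notation separated := (separated d0 r R m R0).

Hypothesis atomic_mono : forall n (e e' : n.-tuple D) (q : formula sg n),
  hom e e' -> atomic q -> sat M q e -> sat M q e'.
Hypothesis atomic_iff : ~~ positive ->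
  forall n (e e' : n.-tuple D) (q : formula sg n),
  hom e e' -> atomic q -> sat M q e' -> sat M q e.

Definition allowed n (p : formula sg n) := existential p && (positive ==>
  negation_free p).

Lemma qf_preserved n (p : formula sg n) (e e' : n.-tuple D) :
  quantifier_free p -> positive ==> negation_free p -> hom e e' -> sat M p e ->
    sat M p e'.
Proof.
move=> qp np ee'; have [hpos|npos] := boolP positive.
  rewrite hpos in np.
  by apply: qf_sat_mono => // q; exact: atomic_mono.
apply: (fun h => proj1 h) _; apply: qf_sat_iff => // q aq.
by split; [exact: atomic_mono|exact: atomic_iff].
Qed.

(** The witnesses of the existential quantifiers form a finite tuple [ys], and a
partial homomorphism defined on it transports the quantifier-free part. *)
Lemma allowed_preserved n (p : formula sg n) (e : n.-tuple D) :
  allowed p -> sat M p e -> exists ys : seq D,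
  forall (e' : n.-tuple D) ys', size ys' = size ys -> hom (ys ++ e) (ys' ++ e') ->
  sat M p e'.
Proof.
move=> /andP[]; elim: p e => {n}[n|n i j|n s v|n p IH|n p IHp q IHq|n p IHp q IHq|n
  p IH|n p IH] e ep np se; last by [].
all: try by exists [::] => e' [|//] _ /= ee'; apply: qf_preserved se.
  by case: se.
move: se => [x /(IH _ ep np)[ys ysP]]; exists (rcons ys x) => e' ys' sys' h.
case/lastP: ys' sys' h => [|ys' x']; rewrite !size_rcons // => -[sys'].
rewrite !cat_rcons => h; exists x'; exact: ysP h.
Qed.

Lemma definable_not_separated (p : formula sg m) :
  allowed p -> (forall t : m.-tuple D, R0 t <-> sat M p t) -> ~ separated.
Proof.
move=> ap defp [t [s [/eqP st /eqP ss R0t nR0s mv]]]; apply: nR0s.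
apply/(defp (Tuple ss)); move/(defp (Tuple st)): R0t =>
  /(allowed_preserved ap)[ys ysP].
have [ys' sys' h] := mv ys; apply: (ysP _ ys') => //.
by apply: hom_swap h; rewrite // (eqP st) (eqP ss).
Qed.

Lemma hom_same_type x x' y y' : same_type x x' -> same_type y y' -> size x = size y ->
  hom x y -> hom x' y'.
Proof.
move=> exx' eyy' sxy xy i a ax' Ra; have [sxx' _ _] := exx'.
have ax : a \in words (r i) (size x) by rewrite sxx'.
apply: (R_inv (z := y @ a)); first by rewrite size_sel (size_words ax).
  by apply: (same_type_sel (n := r i)) => //; rewrite -sxy.
apply: xy => //; apply: R_inv Ra; first by rewrite size_sel (size_words ax).
by apply: same_type_sym; apply: (same_type_sel (n := r i)).
Qed.

Lemma type_representatives : exists reps : seq (seq D),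
  (forall t, t \in reps -> size t = m) /\
  (forall t, size t = m -> exists2 t', t' \in reps & same_type t t').
Proof.
pose rz P : seq D :=
  if pselect (exists z, size z = m /\ tp d0 Delta b m z = P) is left e
  then sval (cid e) else nseq m d0.
have rzP z : size z = m -> size (rz (tp d0 Delta b m z)) = m /\
    tp d0 Delta b m (rz (tp d0 Delta b m z)) = tp d0 Delta b m z.
  by move=> sz; rewrite /rz; case: pselect => [e|[]]; [case: cid | exists z].
exists (map rz (types d0 Delta b m)); split=> [_ /mapP[P _ ->]|t st].
  by rewrite /rz; case: pselect => [e|_]; [case: (cid e) => ? [] | rewrite size_nseq].
exists (rz (tp d0 Delta b m t)).
  by rewrite map_f //; apply: (tp_types d0 b_gt2 b_ar F_bounds b_F).
have [sr tr] := rzP t st.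
by apply/(tp_eq d0 Delta b_gt2 b_ar st sr).
Qed.

(** For representatives [t] and [s] of the types inside and outside [R0] some
tuple [wit (t, s)] admits no partial homomorphism sending [t] to [s].  With
[X] containing all of them, [R0] is defined by a disjunction over the [t]:
there are values for [X] at which all literals true of [X ++ t] hold. *)
Lemma not_separated_definable : ~ separated ->
  exists2 p : formula sg m, allowed p & forall t : m.-tuple D, R0 t <-> sat M p t.
Proof.
move=> nsep; have [reps [reps_size repsP]] := type_representatives.
pose wit ts : seq D :=
  if pselect (exists x, ~ exists2 y, size y = size x & hom (ts.1 ++ x) (ts.2 ++ y))
  is left e then sval (cid e) else [::].
(* The entry [d0] provides a variable for [true_formula]. *)
pose X := d0 :: flatten [seq wit (t, s) | t <- reps, s <- reps].
have homX t z y : t \in reps -> R0 t -> size z = m -> size y = size X ->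
    hom (t ++ X) (z ++ y) -> R0 z.
  move=> tr R0t sz sy h; apply: contrapT => nR0z.
  have st := reps_size _ tr.
  have [s sr ezs] := repsP _ sz.
  have ss := reps_size _ sr.
  have [g gaut gz] := same_type_automorphism Delta_homogeneous ezs.
  have nR0s : ~ R0 s.
    by move=> R0s; apply: nR0z; apply: (R0_inv ss) R0s; exact: same_type_sym.
  have [x nx] : exists x, ~ exists2 y, size y = size x & hom (t ++ x) (s ++ y).
    apply/existsNP => mv; apply: nsep; exists t, s; split=> // x.
  have e : exists x, ~ exists2 y, size y = size x & hom ((t, s).1 ++ x) ((t,
    s).2 ++ y).
    by exists x.
  have nw : ~ exists2 y, size y = size (wit (t, s)) & hom (t ++ wit (t, s)) (s ++ y).
    by rewrite /wit; case: pselect => // e'; case: (cid e').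
  apply: nw; have sub : {subset wit (t, s) <= X}.
    move=> d dw; rewrite inE; apply/orP; right; apply/flattenP.
    by exists (wit (t, s)) => //; apply: allpairs_f.
  have h' : hom (t ++ X) (s ++ map g y).
    apply: hom_same_type h; last by rewrite !size_cat st sz sy.
      exact: same_type_refl.
    by rewrite -gz -map_cat; exact: automorphism_same_type.
  pose w := pos X (wit (t, s)).
  have wX : w \in words (size (wit (t, s))) (size X) by exact: pos_words.
  pose u := iota 0 m ++ [seq m + j | j <- w].
  have uX : u \in words (m + size (wit (t, s))) (m + size X).
    apply: cat_words; first by apply: iota_words; rewrite leq_addr.
    rewrite mem_words size_map (size_words wX) eqxx all_map.
    by apply: sub_all (words_all wX) => j /=; rewrite ltn_add2l.
  have selu z1 z2 : size z1 = m -> size z2 = size X ->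
      (z1 ++ z2) @ u = z1 ++ z2 @ w.
    move=> sz1 sz2; rewrite sel_cat sel_iota0 ?size_cat ?sz1 ?leq_addr //.
    rewrite take_size_cat //; congr cat; rewrite /sel -map_comp.
    apply: eq_map => j /=; rewrite nth_cat sz1 ltnNge leq_addr /=.
    by rewrite addKn.
  exists (map g y @ w); first by rewrite size_sel (size_words wX).
  have := hom_sel _ h' (u := u) (n := m + size (wit (t, s))).
  rewrite !selu ?size_map // sel_pos //; apply;
    rewrite !size_cat ?size_map ?st ?ss ?sy //.
pose arg := {i : I & (r i).-tuple 'I_(size X + m)}.
pose vars (ia : arg) : (r (tag ia)).-tuple 'I_(size X + m) := tagged ia.
pose true_formula : formula sg (size X + m) := FEq sg ord0 ord0.
pose diag t : formula sg (size X + m) := conj_all true_formula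
  [seq lit (vars ia) | ia <- enum {: arg} &
    `[< R (tag ia) ((X ++ t) @ map val (vars ia)) >]].
pose body := disj_all [seq diag t | t <- reps & `[< R0 t >]].
have body_qf : quantifier_free body.
  rewrite quantifier_free_disj all_map; apply/allP => t _ /=.
  by rewrite quantifier_free_conj all_map; apply/allP => ia _ /=.
have body_pos : positive ==> negation_free body.
  apply/implyP => hpos; rewrite negation_free_disj all_map; apply/allP => t _ /=.
  by rewrite negation_free_conj all_map; apply/allP => ia _ /=; exact: lit_pos.
exists (exists_n body).
  rewrite /allowed existential_exists_n ?qf_existential //=.
  by apply/implyP => hpos; apply: negation_free_exists_n; exact: (implyP body_pos).
have diagP t (e : (size X + m).-tuple D) : size t = m ->
    sat M (diag t) e <-> hom (X ++ t) e.
  move=> st; rewrite sat_conj; split=> [[_ h] i a|h].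
    rewrite size_cat st => aN Ra.
    have sa : size a == r i by rewrite (size_words aN).
    have [a' a'E] : exists a' : (r i).-tuple 'I_(size X + m), map val a' = a.
      exists [tuple inord (nth 0 a j) | j < r i].
      apply: (@eq_from_nth _ 0); rewrite size_map size_tuple ?(eqP sa) // => j jr.
      rewrite (nth_map ord0) ?size_tuple //.
      rewrite -[j]/(nat_of_ord (Ordinal jr)) -tnth_nth tnth_mktuple /= inordK //.
      exact: words_lt aN jr.
    have := h (Tagged (fun i => (r i).-tuple 'I_(size X + m)) a').
    rewrite mem_filter mem_enum andbT /= a'E => /(_ (asboolT Ra)).
    by rewrite sat_lit a'E.
  split=> // ia; rewrite mem_filter => /andP[/asboolP Ria _]; rewrite sat_lit.
  apply: h Ria; rewrite mem_words size_map size_tuple eqxx size_cat st /=.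
  by apply/allP => _ /mapP[j _ ->] /=; exact: ltn_ord.
move=> t; rewrite sat_exists_n; split=> [R0t|[ys /sat_disj[t' ]]].
  have [t' t'r ett'] := repsP t (size_tuple t).
  have st' := reps_size _ t'r.
  have [g gaut gt'] := same_type_automorphism Delta_homogeneous (same_type_sym ett').
  have sX : size (map g X) == size X by rewrite size_map.
  exists (Tuple sX); apply/sat_disj; exists t'.
    rewrite mem_filter t'r andbT; apply/asboolP.
    exact: (R0_inv (size_tuple t)) R0t.
  apply/diagP => //.
  have -> : [tuple of Tuple sX ++ t] = map g (X ++ t') :> seq D.
    by rewrite map_cat gt'.
  have auto := automorphism_same_type d0 (X ++ t') gaut.
  exact: hom_same_type (same_type_refl _ _ _) auto erefl _.
rewrite mem_filter => /andP[/asboolP R0t' t'r] /diagP - /(_ (reps_size _ t'r)) h.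
apply: (homX t' t ys) => //; rewrite ?size_tuple //.
by apply: hom_swap h; rewrite ?size_tuple // (reps_size _ t'r).
Qed.

End Definability.

(** * The decision procedure *)

Section Program.
Variables (b : nat) (Q : seq nat) (act_dom : seq (seq nat)) (act_val : seq nat).
Variables (eq_colours : seq nat) (rel_colours : seq (seq nat)).

Definition act_table c f := nth 0 act_val (index (c :: f) act_dom).

Definition types_list K :=
  [seq P <- lists Q (size (words b K)) | compatible b Q act_table K P].

(** The coordinate 0 pads [v] to length [b]; the relations looked up depend on
the first [size v] coordinates only. *)
Definition colour_at K P v := lookup b K P (v ++ nseq (b - size v) 0).

(** The value of the quantifier-free formula with decoded code [l], from the
values [vals] of the formulas with smaller codes. *)
Definition eval_node K P a (vals : seq bool) (l : seq nat) : bool :=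
  let x := nth 0 l 1 in let y := nth 0 l 2 in
  if head 0 l == 1 then colour_at K P [:: nth 0 a x; nth 0 a y] \in eq_colours
  else if head 0 l == 2 then
    colour_at K P (sel 0 a (drop 2 l)) \in nth [::] rel_colours x
  else if head 0 l == 3 then ~~ nth false vals x
  else if head 0 l == 4 then nth false vals x && nth false vals y
  else if head 0 l == 5 then nth false vals x || nth false vals y
  else false.

(** Subformulas have smaller codes, so course-of-values recursion on the code
evaluates a formula. *)
Definition eval_table K P a n : seq bool :=
  iter n (fun vals =>
    rcons vals (eval_node K P a vals (CodeSeq.decode (size vals)))) [::].

Definition eval K P a c := nth false (eval_table K P a c.+1) c.

Definition same_startb m K p p' :=
  all (fun w => lookup b K p w == lookup b K p' w) (words b m).

Definition apply_table (W Bs : seq (seq nat)) p := nth [::] Bs (index p W).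

Definition certificateb m c0 (Ls : seq (nat * nat)) K (W Bs : seq (seq nat)) p0 :=
  [&& eval K p0 (iota 0 m) c0, ~~ eval K (apply_table W Bs p0) (iota 0 m) c0 &
    all (fun p => same_startb m K p0 p ==>
      [&& same_startb m K (apply_table W Bs p0) (apply_table W Bs p),
        all (fun rho => apply_table W Bs (reindex b K p rho) ==
                        reindex b K (apply_table W Bs p) rho)
          [seq rho <- words K K | take m rho == iota 0 m] &
        all (fun l => eval K p (iota m l.1) l.2 ==>
                      eval K (apply_table W Bs p) (iota m l.1) l.2) Ls]) W].

Definition exponent (Ls : seq (nat * nat)) := b + sumn [seq l.1 | l <- Ls].

(** Exhaustive search for a certificate; [Bs] lists the values of [B] along
[types_list K]. *)
Definition separatedb m c0 (Ls : seq (nat * nat)) : bool :=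
  let K := m + exponent Ls in let W := types_list K in
  has (fun Bs => has (certificateb m c0 Ls K W Bs) W) (lists W (size W)).

End Program.

Lemma computable_lists {A} {eA : encoding A} (T : eqType) {eT : encoding T}
    (s : A -> seq T) (n : A -> nat) :
  computable s -> computable n -> computable (fun a => lists (s a) (n a)).
Proof.
move=> cs cn; rewrite /lists.
apply: computable_iter => //; last exact: computable_const.
prove_computable.
by apply: (computable_comp (h := fst) cs); prove_computable.
Qed.

Section ProgramComputable.
Context {A : Type} {eA : encoding A}.

Lemma computable_words (n N : A -> nat) :
  computable n -> computable N -> computable (fun a => words (n a) (N a)).
Proof. by move=> cn cN; apply: computable_lists => //; prove_computable. Qed.

Lemma computable_sel (x u : A -> seq nat) :
  computable x -> computable u -> computable (fun a => sel 0 (x a) (u a)).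
Proof.
move=> cx cu; rewrite /sel; apply: computable_map => //.
apply: computable_nth; last by prove_computable.
by apply: (computable_comp (h := fst) cx); prove_computable.
Qed.

Lemma computable_lookup b (K : A -> nat) (P w : A -> seq nat) :
  computable K -> computable P -> computable w ->
  computable (fun a => lookup b (K a) (P a) (w a)).
Proof.
move=> cK cP cw; apply: computable_nth => //; apply: computable_index => //.
by apply: computable_words => //; exact: computable_const.
Qed.

Lemma computable_act_table act_dom act_val (c : A -> nat) (f : A -> seq nat) :
  computable c -> computable f ->
  computable (fun a => act_table act_dom act_val (c a) (f a)).
Proof. by move=> cc cf; rewrite /act_table; prove_computable. Qed.

End ProgramComputable.

Ltac program_step :=
  first [ apply: computable_sel | apply: computable_lookup
        | apply: computable_act_table
        | apply: computable_words | apply: computable_lists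
        | computable_list_step ].

Ltac prove_program := repeat (program_step; simpl).

Lemma computable_reindex {A} {eA : encoding A} b (K : A -> nat) (P rho : A ->
  seq nat) :
  computable K -> computable P -> computable rho ->
  computable (fun a => reindex b (K a) (P a) (rho a)).
Proof.
move=> cK cP cr.
have H : computable (fun p : nat * seq nat * seq nat => reindex b p.1.1 p.1.2 p.2).
  by rewrite /reindex; prove_program.
by apply: (computable_comp (h := fun a => (K a, P a, rho a)) H); prove_program.
Qed.

Lemma computable_compatible {A} {eA : encoding A} b Q act_dom act_val
    (K : A -> nat) (P : A -> seq nat) :
  computable K -> computable P ->
  computable (fun a => compatible b Q (act_table act_dom act_val) (K a) (P a)).
Proof.
move=> cK cP.
have H : computable (fun p : nat * seq nat =>
    compatible b Q (act_table act_dom act_val) p.1 p.2).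
  by rewrite /compatible; prove_program.
by apply: (computable_comp (h := fun a => (K a, P a)) H); prove_program.
Qed.

Lemma computable_types_list {A} {eA : encoding A} b Q act_dom act_val
    (K : A -> nat) : computable K ->
  computable (fun a => types_list b Q act_dom act_val (K a)).
Proof.
move=> cK; rewrite /types_list; apply: computable_filter => /=; last by prove_program.
apply: computable_compatible; last by prove_program.
by apply: (computable_comp (h := fst) cK); prove_program.
Qed.

Lemma computable_colour_at {A} {eA : encoding A} b (K : A -> nat) (P v : A ->
  seq nat) :
  computable K -> computable P -> computable v ->
  computable (fun a => colour_at b (K a) (P a) (v a)).
Proof. by move=> cK cP cv; rewrite /colour_at; prove_program. Qed.

Lemma computable_eval {A} {eA : encoding A} b eq_colours rel_colours
    (K : A -> nat) (P a : A -> seq nat) (c : A -> nat) :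
  computable K -> computable P -> computable a -> computable c ->
  computable (fun i => eval b eq_colours rel_colours (K i) (P i) (a i) (c i)).
Proof.
move=> cK cP ca cc.
have node : computable (fun p : nat * seq nat * seq nat * seq bool * seq nat =>
    eval_node b eq_colours rel_colours p.1.1.1.1 p.1.1.1.2 p.1.1.2 p.1.2 p.2).
  by rewrite /eval_node; repeat (first [apply: computable_colour_at |
    program_step]; simpl).
have H : computable (fun p : nat * seq nat * seq nat * nat =>
    eval b eq_colours rel_colours p.1.1.1 p.1.1.2 p.1.2 p.2).
  rewrite /eval /eval_table; apply: computable_nth; last by prove_program.
  apply: computable_iter; [by prove_program| |by prove_program].
  apply: computable_rcons; first by prove_program.
  apply: (computable_comp (h := fun q : nat * seq nat * seq nat * nat * seq bool =>
    (q.1.1.1.1, q.1.1.1.2, q.1.1.2, q.2, CodeSeq.decode (size q.2))) node).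
  by prove_program.
by apply: (computable_comp (h := fun i => (K i, P i, a i, c i)) H); prove_program.
Qed.

Lemma computable_apply_table {A} {eA : encoding A}
    (W Bs : A -> seq (seq nat)) (p : A -> seq nat) :
  computable W -> computable Bs -> computable p ->
  computable (fun a => apply_table (W a) (Bs a) (p a)).
Proof. by move=> cW cB cp; rewrite /apply_table; prove_program. Qed.

Lemma computable_same_startb {A} {eA : encoding A} b
    (m K : A -> nat) (p q : A -> seq nat) :
  computable m -> computable K -> computable p -> computable q ->
  computable (fun a => same_startb b (m a) (K a) (p a) (q a)).
Proof.
move=> cm cK cp cq.
have H : computable (fun i : nat * nat * seq nat * seq nat =>
    same_startb b i.1.1.1 i.1.1.2 i.1.2 i.2).
  by rewrite /same_startb; prove_program.
by apply: (computable_comp (h := fun a => (m a, K a, p a, q a)) H); prove_program.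
Qed.

Lemma computable_separatedb (b : nat) (Q : seq nat) (act_dom : seq (seq nat))
    (act_val : seq nat) (eq_colours : seq nat) (rel_colours : seq (seq nat)) :
  computable (fun p : nat * nat * seq (nat * nat) =>
    separatedb b Q act_dom act_val eq_colours rel_colours p.1.1 p.1.2 p.2).
Proof.
pose I := (nat * nat * seq (nat * nat) * nat * seq (seq nat) * seq (seq nat) * seq
  nat)%type.
have H : computable (fun p : I =>
    certificateb b eq_colours rel_colours p.1.1.1.1.1.1 p.1.1.1.1.1.2 p.1.1.1.1.2
      p.1.1.1.2 p.1.1.2 p.1.2 p.2).
  rewrite /certificateb.
  by repeat (first [ apply: computable_eval | apply: computable_apply_table
          | apply: computable_same_startb | apply: computable_reindex
          | program_step]; simpl).
have cK : computable (fun p : nat * nat * seq (nat * nat) => p.1.1 + exponent b p.2).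
  by rewrite /exponent; prove_program.
have cW : computable (fun p : nat * nat * seq (nat * nat) =>
    types_list b Q act_dom act_val (p.1.1 + exponent b p.2)).
  exact: computable_types_list cK.
rewrite /separatedb; apply: computable_has; last by prove_program.
apply: computable_has; last by apply: (computable_comp (h := fst) cW); prove_program.
apply: (computable_comp (h := fun p : nat * nat * seq (nat * nat) * seq (seq nat) *
  seq nat =>
  (p.1.1.1, p.1.1.2, p.1.1.1.1 + exponent b p.1.1.2,
   types_list b Q act_dom act_val (p.1.1.1.1 + exponent b p.1.1.2), p.1.2, p.2)) H).
have c1 : computable (fun p : nat * nat * seq (nat * nat) * seq (seq nat) * seq nat
  => p.1.1).
  by prove_program.
have cK' := computable_comp cK c1.
have cW' := computable_comp cW c1.
by prove_program.
Qed.

Lemma map_table_index (T : eqType) (f : T -> nat) (s : seq T) x :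
  x \in s -> nth 0 (map f s) (index x s) = f x.
Proof. by move=> xs; rewrite (nth_map x) ?index_mem // nth_index. Qed.

Lemma size_eval_table b eqs rels K P a n :
  size (eval_table b eqs rels K P a n) = n.
Proof. by elim: n => //= n IH; rewrite size_rcons IH. Qed.

Lemma nth_eval_table b eqs rels K P a n c : c < n ->
  nth false (eval_table b eqs rels K P a n) c =
  eval_node b eqs rels K P a (eval_table b eqs rels K P a c) (CodeSeq.decode c).
Proof.
elim: n => // n IH; rewrite ltnS leq_eqVlt.
rewrite /eval_table iterS -/(eval_table b eqs rels K P a n) nth_rcons size_eval_table.
by move=> /orP[/eqP ->|lt]; [rewrite ltnn eqxx | rewrite lt IH].
Qed.

Lemma mem_code (s : seq nat) c : c \in s -> c < CodeSeq.code s.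
Proof. exact: (allP (CodeSeq.ltn_code s)). Qed.

Lemma decode_formula_code (sg : signature) n (p : formula sg n) :
  CodeSeq.decode (formula_code p) =
  match p with
  | FFalse _ => [:: 0]
  | FEq _ i j => [:: 1; val i; val j]
  | FRel _ s v => [:: 2, val (enum_rank s) & [seq val i | i <- v]]
  | FNot _ p => [:: 3; formula_code p]
  | FAnd _ p q => [:: 4; formula_code p; formula_code q]
  | FOr _ p q => [:: 5; formula_code p; formula_code q]
  | FEx _ p => [:: 6; formula_code p]
  | FAll _ p => [:: 7; formula_code p]
  end.
Proof. by case: p => *; rewrite -[RHS]CodeSeq.codeK. Qed.

Section Correctness.
Variables (tau : signature) (D : choiceType) (d0 : D) (Delta : structure tau D).
Hypothesis Delta_ordered : ordered (age Delta).
Hypothesis Delta_homogeneous : homogeneous Delta.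
Hypothesis Delta_ramsey : ramsey (age Delta).
Variables (sigma : signature) (Gamma : structure sigma D).
Hypothesis Gamma_automorphism : forall g,
  automorphism Delta g -> isomorphism Gamma Gamma g.
Variable b : nat.
Hypothesis b_gt2 : 2 < b.
Hypothesis b_ar : forall s : tau, (ar s).*2 <= b.
Hypothesis b_sigma : forall s : sigma, ar s <= b.
Variables (nF : nat) (F : 'I_nF -> fin_structure tau).
Hypothesis F_bounds : forall A : fin_structure tau,
  age Delta A <-> forall i, ~ embeds (F i) (@rels _ A).
Hypothesis b_F : forall i, #|F i| <= b.
Implicit Types (z : seq D) (s : sigma).

Local Notation "x @ u" := (sel d0 x u) (at level 20).
Local Notation same_type := (same_type d0 Delta).
Local Notation colour := (colour d0 Delta b).
Local Notation colours := (colours d0 Delta b).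
Local Notation act := (act d0 Delta b).
Local Notation tp := (tp d0 Delta b).

Definition act_dom := [seq c :: f | c <- colours, f <- words b b].
Definition act_val := [seq act (head 0 l) (behead l) | l <- act_dom].
(** The colours of the [b]-tuples in [R]: a finite table for [R] when [R] is
invariant under automorphisms. *)
Definition colours_of (R : seq D -> Prop) :=
  [seq c <- colours | `[< exists z, [/\ size z = b, colour z = c & R z] >]].
Definition eq_colours := colours_of (fun z => nth d0 z 0 = nth d0 z 1).
Definition rel_colours := [seq colours_of (holds_rel d0 Gamma s) | s <- enum sigma].

Lemma act_tableE c f : c \in colours -> f \in words b b ->
  act_table act_dom act_val c f = act c f.
Proof.
move=> cQ fb; rewrite /act_table map_table_index //.
by apply/allpairsP; exists (c, f).
Qed.

Lemma types_listE K : types_list b colours act_dom act_val K = types d0 Delta b K.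
Proof.
apply: eq_filter => P; apply: eq_all => w; case: (boolP (_ \in colours)) => //= cQ.
by apply: eq_in_all => f fb; rewrite act_tableE.
Qed.

Lemma mem_colours_of R z : type_invariant d0 Delta b R -> size z = b ->
  colour z \in colours_of R <-> R z.
Proof.
move=> inv sz; rewrite mem_filter colour_in // andbT.
split=> [/asboolP[z' [sz' /(colourP d0 Delta sz' sz) ezz' Rz']]|Rz].
  exact: inv ezz' Rz'.
by apply/asboolP; exists z.
Qed.

Definition sem n (p : formula sigma n) z := sat Gamma p [tuple nth d0 z i | i < n].

Lemma sem_invariant n (p : formula sigma n) : type_invariant d0 Delta n (sem p).
Proof.
move=> z z' sz ezz'; have [g gaut <-]
  := same_type_automorphism Delta_homogeneous ezz'.
rewrite /sem => /(sat_automorphism _ _ (Gamma_automorphism gaut)).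
set t := map_tuple _ _; set t' := [tuple _ | _ < _].
suff -> : t = t' by [].
by apply: eq_from_tnth => i; rewrite tnth_map !tnth_mktuple (nth_map d0) // sz.
Qed.

Lemma holds_rel_invariant s : type_invariant d0 Delta b (holds_rel d0 Gamma s).
Proof.
move=> z z' sz ezz'; have [g gaut <-]
  := same_type_automorphism Delta_homogeneous ezz'.
have [_ gpres] := Gamma_automorphism gaut.
rewrite /holds_rel gpres.
set t := map_tuple _ _; set t' := [tuple _ | _ < _].
suff -> : t = t' by [].
apply: eq_from_tnth => i; rewrite tnth_map !tnth_mktuple (nth_map d0) // sz.
exact: leq_trans (ltn_ord i) (b_sigma s).
Qed.

Lemma eq_invariant : type_invariant d0 Delta b (fun z => nth d0 z 0 = nth d0 z 1).
Proof.
move=> z z' sz ezz'; have [g gaut <-]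
  := same_type_automorphism Delta_homogeneous ezz'.
by rewrite !(nth_map d0) ?sz //; [move=> ->|lia|lia].
Qed.

Section Evaluation.
Variables (K : nat) (z : seq D).
Hypothesis K_gt0 : 0 < K.
Hypothesis z_size : size z = K.

Lemma colour_atE R n v : n <= b -> v \in words n K ->
  type_invariant d0 Delta b R ->
  colour_at b K (tp K z) v \in colours_of R <-> R (z @ (v ++ nseq (b - n) 0)).
Proof.
move=> nb vK inv; rewrite /colour_at (size_words vK).
have pK : v ++ nseq (b - n) 0 \in words b K.
  have {2}-> : b = n + (b - n) by lia.
  exact: cat_words vK (nseq_words _ K_gt0).
rewrite lookup_tp // mem_colours_of //.
by rewrite size_sel (size_words pK).
Qed.

Lemma eval_tableE n (p : formula sigma n) a N : quantifier_free p ->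
  a \in words n K -> formula_code p < N ->
  nth false (eval_table b eq_colours rel_colours K (tp K z) a N) (formula_code p) =
  `[< sem p (z @ a) >].
Proof.
move=> qp aK; elim: p a aK N qp =>
  {n}[n|n i j|n s v|n p IH|n p IHp q IHq|n p IHp q IHq|n p IH|n p IH] a aK N qp lt //;
  rewrite nth_eval_table // decode_formula_code /eval_node.
- by apply/esym/asboolP.
- rewrite /=; have ijK : [:: nth 0 a i; nth 0 a j] \in words 2 K.
    by rewrite mem_words /= !(words_lt aK).
  have := colour_atE (ltnW b_gt2) ijK eq_invariant.
  have -> : (nth d0 (z @ ([:: nth 0 a i; nth 0 a j] ++ nseq (b - 2) 0)) 0 =
      nth d0 (z @ ([:: nth 0 a i; nth 0 a j] ++ nseq (b - 2) 0)) 1) =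
      sem (FEq sigma i j) (z @ a).
    by rewrite /sem /= !tnth_mktuple !nth_sel ?(size_words aK).
  by move=> e; apply/idP/asboolP; rewrite e.
- rewrite /= drop0 (nth_map s) -?cardE // nth_enum_rank.
  have vK : [seq val i | i <- v] \in words (ar s) n.
    by rewrite mem_words size_map size_tuple eqxx; apply/allP => _ /mapP[i _ ->] /=.
  have avK := sel_words aK vK.
  have := colour_atE (b_sigma s) avK (holds_rel_invariant (s := s)).
  have -> : holds_rel d0 Gamma s (z @ (sel 0 a [seq val i | i <- v]
    ++ nseq (b - ar s) 0)) =
      sem (FRel v) (z @ a).
    rewrite /sem /= /holds_rel; congr Gamma; apply: eq_from_tnth => i.
    rewrite tnth_mktuple tnth_map tnth_mktuple sel_cat nth_cat size_sel (size_words
      avK) ltn_ord.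
    rewrite sel_sel ?(size_words aK) ?(words_all vK) //.
    rewrite nth_sel ?size_map ?size_tuple // (nth_map (tnth v i)) ?size_tuple //.
    by rewrite -tnth_nth.
  by move=> e; apply/idP/asboolP; rewrite e.
- have lt' : formula_code p < CodeSeq.code [:: 3; formula_code p].
    by apply: mem_code; rewrite !inE eqxx orbT.
  by rewrite /= (IH _ aK _ qp lt') /sem /= asbool_neg.
- have lt1 : formula_code p < CodeSeq.code [:: 4; formula_code p; formula_code q].
    by apply: mem_code; rewrite !inE eqxx orbT.
  have lt2 : formula_code q < CodeSeq.code [:: 4; formula_code p; formula_code q].
    by apply: mem_code; rewrite !inE eqxx !orbT.
  have /andP[qp1 qp2] := qp.
  by rewrite /= (IHp _ aK _ qp1 lt1) (IHq _ aK _ qp2 lt2) /sem /= asbool_and.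
have lt1 : formula_code p < CodeSeq.code [:: 5; formula_code p; formula_code q].
  by apply: mem_code; rewrite !inE eqxx orbT.
have lt2 : formula_code q < CodeSeq.code [:: 5; formula_code p; formula_code q].
  by apply: mem_code; rewrite !inE eqxx !orbT.
have /andP[qp1 qp2] := qp.
by rewrite /= (IHp _ aK _ qp1 lt1) (IHq _ aK _ qp2 lt2) /sem /= asbool_or.
Qed.

Lemma evalE n (p : formula sigma n) a : quantifier_free p -> a \in words n K ->
  eval b eq_colours rel_colours K (tp K z) a (formula_code p) = `[< sem p (z @ a) >].
Proof. by move=> qp aK; rewrite /eval eval_tableE. Qed.

End Evaluation.

Section Separation.
Variable target : qf_formula sigma.
Variables (I : Type) (q : I -> qf_formula sigma) (Lc : seq (nat * nat)).
Hypothesis Lc_spec : forall f : nat * nat -> bool,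
  all f Lc <-> forall i, f (qf_arity (q i), formula_code (q i)).
Local Notation m := (qf_arity target).
Local Notation r := (fun i => qf_arity (q i)).
Local Notation R := (fun i => sem (q i)).
Local Notation R0 := (sem target).
Variable ieq : I.
Hypothesis r_ieq : r ieq = 2.
Hypothesis R_ieq : forall z, R ieq z <-> nth d0 z 0 = nth d0 z 1.

Let k := exponent b Lc.
Let K := m + k.
Let W := types d0 Delta b K.
Local Notation ev := (eval b eq_colours rel_colours K).
Local Notation certificate := (certificate d0 Delta b r R m R0 k).

Let W_tp p : p \in W -> exists2 z, size z = K & tp K z = p.
Proof. by move/(mem_types d0 b_gt2 b_ar F_bounds b_F). Qed.

Let b_k : b <= k. Proof. exact: leq_addr. Qed.

Let K_gt0 : 0 < K. Proof. by rewrite /K; lia. Qed.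

Let r_k i : r i <= k.
Proof.
have /Lc_spec/(_ i) // : all (fun l => l.1 <= k) Lc.
rewrite /k /exponent; elim: (Lc) => //= l L IH; apply/andP; split; first by lia.
by apply: sub_all IH => l' /= le; lia.
Qed.

Let evP (p : qf_formula sigma) P a : P \in W -> a \in words (qf_arity p) K ->
  ev P a (formula_code p) <-> rel_at d0 Delta b m k (sem p) P a.
Proof.
move=> /W_tp[z sz <-] aK; rewrite (evalE K_gt0 sz (qf_formP p) aK).
rewrite (rel_at_tp b_gt2 b_ar (sem_invariant (p := p)) sz aK).
by split=> /asboolP.
Qed.

Let reindex_W p rho : p \in W -> rho \in words K K -> reindex b K p rho \in W.
Proof.
move=> /W_tp[z sz <-] rK; rewrite -tp_reindex //.
by apply: tp_types => //; rewrite size_sel (size_words rK).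
Qed.

Lemma certificate_ext B B' p0 : {in W, B =1 B'} -> certificate B p0 ->
  certificate B' p0.
Proof.
move=> BB' [p0W BW R0p nR0p H]; split=> //.
- by move=> p pW; rewrite -BB' // BW.
- by rewrite -BB'.
move=> p pW /(H p pW)[st rh pr]; rewrite -!BB' //; split=> // rho rK rm.
by rewrite -rh // BB' // reindex_W.
Qed.

Lemma certificatebP Bs p0 : {in W, forall p, apply_table W Bs p \in W} -> p0 \in W ->
  certificateb b eq_colours rel_colours m (formula_code target) Lc K W Bs p0 <->
  certificate (apply_table W Bs) p0.
Proof.
move=> BW p0W.
have stP p p' : same_startb b m K p p' <-> same_start b m k p p'.
  by split=> [/allP h w /h/eqP|h]; last by apply/allP => w /h/eqP.
have mK : iota 0 m \in words m K by exact: iota0_words.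
have rK i : iota m (r i) \in words (r i) K by exact: (iotar_words m r_k).
split=> [/and3P[e0 ne0 /allP H]|[_ _ R0p nR0p H]].
  split=> //; first exact/evP.
    by move=> /(evP (BW _ p0W) mK) e; rewrite e in ne0.
  move=> p pW /stP st; have := H p pW; rewrite st /= => /and3P[st' /allP rh pr].
  split; first exact/stP.
    by move=> rho rhoK rm; apply/eqP/rh; rewrite mem_filter rm eqxx.
  move=> i /(evP pW (rK i)) e; apply/(evP (BW _ pW) (rK i)).
  by have /Lc_spec/(_ i)/implyP := pr; apply.
apply/and3P; split; first exact/evP.
  by apply/negP => /(evP (BW _ p0W) mK).
apply/allP => p pW; apply/implyP => /stP/(H p pW)[st rh pr]; apply/and3P; split.
- exact/stP.
- by apply/allP => rho; rewrite mem_filter => /andP[/eqP rm rhoK]; apply/eqP/rh.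
apply/Lc_spec => i; apply/implyP => /(evP pW (rK i))/pr h.
exact/(evP (BW _ pW) (rK i)).
Qed.

Lemma separatedbP :
  separatedb b colours act_dom act_val eq_colours rel_colours m
    (formula_code target) Lc <-> separated d0 r R m R0.
Proof.
have R_inv i : type_invariant d0 Delta (r i) (R i) by exact: sem_invariant.
have R0_inv : type_invariant d0 Delta m R0 by exact: sem_invariant.
rewrite /separatedb types_listE -/k -/K -/W; split.
  move=> /hasP[Bs BsW /hasP[p0 p0W]].
  move/certificatebP => cert.
  apply: (certificate_separated Delta_homogeneous b_gt2 b_ar F_bounds b_F
    R_inv r_ieq R0_inv b_k r_k (B := apply_table W Bs) (p0 := p0)).
  apply: cert => // p pW; move: BsW; rewrite mem_lists => /andP[/eqP sB /allP].
  by apply; rewrite mem_nth // sB index_mem.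
move=> /(separated_certificate Delta_ordered Delta_homogeneous Delta_ramsey b_gt2
  b_ar F_bounds b_F R_inv r_ieq R_ieq R0_inv r_k)[B [p0 cert]].
have [p0W BW _ _ _] := cert.
have BE p : p \in W -> apply_table W (map B W) p = B p.
  by move=> pW; rewrite /apply_table (nth_map [::]) ?index_mem // nth_index.
apply/hasP; exists (map B W).
  by rewrite mem_lists size_map eqxx all_map; apply/allP => p /BW.
apply/hasP; exists p0 => //; apply/certificatebP => //.
  by move=> p pW; rewrite BE // BW.
by apply: certificate_ext cert => p pW; rewrite BE.
Qed.

End Separation.
End Correctness.

(** * Decidability of Expr_ex and Expr_ep *)

Lemma computable_decidable (I : Type) (code : I -> nat) (P : I -> Prop)
    (dec : nat -> bool) : computable dec ->
  (forall x, dec (code x) <-> P x) -> decidable_problem code P.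
Proof.
move=> [g rg gE] decP; exists (fun v => g (tnth v ord0)) => // x.
apply: etrans (gE (code x)) _; congr nat_of_bool.
by apply/idP/asboolP => /decP.
Qed.

Definition eq_qf sigma : qf_formula sigma :=
  @QFFormula sigma 2 (FEq sigma ord0 ord_max) isT.

Definition neg_qf sigma (p : qf_formula sigma) : qf_formula sigma :=
  @QFFormula sigma (qf_arity p) (FNot p) (qf_formP p).

Section Codes.

Definition formula_pair sigma (p : qf_formula sigma) := (qf_arity p, formula_code p).

Definition parse e := (nth 0 (CodeSeq.decode e) 0, nth 0 (CodeSeq.decode e) 1).
Definition parse_input c := [seq parse e | e <- CodeSeq.decode c].

Definition ep_list (L : seq (nat * nat)) := (2, CodeSeq.code [:: 1; 0; 1]) :: L.
Definition neg_pair (l : nat * nat) := (l.1, CodeSeq.code [:: 3; l.2]).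
(** Existential formulas are the existential positive ones over the sources, the
equality and all their complements. *)
Definition ex_list L := ep_list L ++ map neg_pair (ep_list L).

Lemma parse_inputE sigma (x : expr_input sigma) :
  parse_input (expr_input_code x) =
  formula_pair (target x) :: map (@formula_pair sigma) (sources x).
Proof.
rewrite /parse_input /expr_input_code CodeSeq.codeK -map_comp /=.
have E (p : qf_formula sigma) : parse (qf_formula_code p) = formula_pair p.
  by rewrite /parse /qf_formula_code CodeSeq.codeK.
by rewrite E; congr cons; apply: eq_map.
Qed.

Variables (b : nat) (Q : seq nat) (act_dom : seq (seq nat)) (act_val : seq nat).
Variables (eq_colours : seq nat) (rel_colours : seq (seq nat)).

Definition decide (lst : seq (nat * nat) -> seq (nat * nat)) c :=
  let fs := parse_input c in
  ~~ separatedb b Q act_dom act_val eq_colours rel_colours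
    (head (0, 0) fs).1 (head (0, 0) fs).2 (lst (behead fs)).

Lemma computable_parse_input {A} {eA : encoding A} (c : A -> nat) :
  computable c -> computable (fun a => parse_input (c a)).
Proof. by move=> cc; rewrite /parse_input /parse; prove_computable. Qed.

Lemma computable_decide lst :
  computable lst -> computable (decide lst).
Proof.
move=> cl; rewrite /decide; apply: computable_negb.
have cp := computable_parse_input computable_id.
have cb := computable_behead cp.
apply: (computable_comp (h := fun c => ((head (0, 0) (parse_input c)).1,
  (head (0, 0) (parse_input c)).2, lst (behead (parse_input c))))
  (computable_separatedb b Q act_dom act_val eq_colours rel_colours)).
apply: computable_pair; last exact: computable_comp cl cb.
by apply: computable_pair; [apply: computable_fst|apply: computable_snd];
  apply: computable_head.
Qed.

End Codes.

Lemma computable_ep_list : computable ep_list.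
Proof. by rewrite /ep_list; prove_computable. Qed.

Lemma computable_ex_list : computable ex_list.
Proof.
apply: computable_cat; first exact: computable_ep_list.
apply: computable_map; last exact: computable_ep_list.
apply: computable_pair; first by prove_computable.
have H : computable (fun p : seq (nat * nat) * (nat * nat) => [:: 3; p.2.2]).
  by prove_computable.
exact: computable_enc H.
Qed.

Section Instances.
Variables (D : choiceType) (d0 : D) (sigma : signature) (Gamma : structure sigma D).
Variable x : expr_input sigma.
Local Notation n := (size (sources x)).
Local Notation sg := (source_signature x).
Local Notation M := (source_structure Gamma (x := x)).

Definition ep_index := option 'I_n.

Definition ep_formula (o : ep_index) : qf_formula sigma :=
  if o is Some i then source i else eq_qf sigma.

(** The literals available in existential positive formulas: an equation for
[None], a source relation for [Some i]. *)
Definition ep_lit N (o : ep_index) :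
    (qf_arity (ep_formula o)).-tuple 'I_N -> formula sg N :=
  match o return (qf_arity (ep_formula o)).-tuple 'I_N -> formula sg N with
  | Some i => fun a => @FRel sg N i a
  | None => fun a => FEq sg (tnth a ord0) (tnth a ord_max)
  end.

Definition ex_index := (bool * ep_index)%type.

Definition ex_formula (i : ex_index) : qf_formula sigma :=
  let: (pos, o) := i in if pos then ep_formula o else neg_qf (ep_formula o).

Definition ex_lit N (i : ex_index) :
    (qf_arity (ex_formula i)).-tuple 'I_N -> formula sg N :=
  match i return (qf_arity (ex_formula i)).-tuple 'I_N -> formula sg N with
  | (true, o) => fun a => ep_lit a
  | (false, o) => fun a => FNot (ep_lit a)
  end.

Lemma sel_tuple N r (e : N.-tuple D) (a : r.-tuple 'I_N) :
  [tuple nth d0 (sel d0 e (map val a)) i | i < r] = map_tuple (tnth e) a.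
Proof.
apply: eq_from_tnth => i; rewrite tnth_mktuple tnth_map.
rewrite nth_sel ?size_map ?size_tuple // (nth_map (tnth a i)) ?size_tuple //.
by rewrite -!tnth_nth.
Qed.

Lemma sat_ep_lit N o (a : (qf_arity (ep_formula o)).-tuple 'I_N) (e : N.-tuple D) :
  sat M (ep_lit a) e <-> sem d0 Gamma (ep_formula o) (sel d0 e (map val a)).
Proof.
rewrite /sem sel_tuple; case: o a => [i|] a //=.
by rewrite !tnth_map.
Qed.

Lemma sat_ex_lit N i (a : (qf_arity (ex_formula i)).-tuple 'I_N) (e : N.-tuple D) :
  sat M (ex_lit a) e <-> sem d0 Gamma (ex_formula i) (sel d0 e (map val a)).
Proof.
case: i a => [[] o] a; first exact: sat_ep_lit.
by rewrite /= (sat_ep_lit (o := o)).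
Qed.

Lemma atomic_ep_lit N (q : formula sg N) : atomic q ->
  exists o (a : (qf_arity (ep_formula o)).-tuple 'I_N), q = ep_lit a.
Proof.
case: q => // [N' i j|N' s v] _.
  by exists None, [tuple i; j].
by exists (Some s), v.
Qed.

Lemma hom_lit (I : Type) (q : I -> qf_formula sigma)
    (lit : forall N (i : I), (qf_arity (q i)).-tuple 'I_N -> formula sg N) :
  (forall N i (a : (qf_arity (q i)).-tuple 'I_N) (e : N.-tuple D),
    sat M (lit N i a) e <-> sem d0 Gamma (q i) (sel d0 e (map val a))) ->
  forall N i (a : (qf_arity (q i)).-tuple 'I_N) (e e' : N.-tuple D),
  hom d0 (fun i => qf_arity (q i)) (fun i => sem d0 Gamma (q i)) e e' ->
  sat M (lit N i a) e -> sat M (lit N i a) e'.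
Proof.
move=> litP N i a e e' ee'; rewrite !litP; apply: ee'.
rewrite mem_words size_map !size_tuple eqxx.
by apply/allP => _ /mapP[j _ ->] /=.
Qed.

Lemma all_ep_list f :
  all f (ep_list (map (@formula_pair sigma) (sources x))) <->
  forall o : ep_index, f (formula_pair (ep_formula o)).
Proof.
rewrite /= all_map; split=> [/andP[feq h] [i|] //|h].
  exact: (all_tnthP (t := in_tuple (sources x)) h).
apply/andP; split; first exact: (h None).
by apply/(all_tnthP (t := in_tuple (sources x))) => i; exact: (h (Some i)).
Qed.

Lemma all_ex_list f :
  all f (ex_list (map (@formula_pair sigma) (sources x))) <->
  forall i : ex_index, f (formula_pair (ex_formula i)).
Proof.
rewrite /ex_list all_cat [all f (map _ _)]all_map; split.
  by move=> /andP[/all_ep_list h1 /all_ep_list h2] [[] o]; [exact: h1|exact: h2].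
move=> h; apply/andP; split; apply/all_ep_list => o; first exact: (h (true, o)).
exact: (h (false, o)).
Qed.

Lemma sem_eq z : sem d0 Gamma (eq_qf sigma) z <-> nth d0 z 0 = nth d0 z 1.
Proof. by rewrite /sem /= !tnth_mktuple. Qed.

Lemma sem_tuple (p : qf_formula sigma) (t : (qf_arity p).-tuple D) :
  sem d0 Gamma p t <-> sat Gamma p t.
Proof.
rewrite /sem; suff -> : [tuple nth d0 t i | i < qf_arity p] = t by [].
by apply: eq_from_tnth => i; rewrite tnth_mktuple (tnth_nth d0).
Qed.

End Instances.

Section Main.
Variables (tau : signature) (D : choiceType) (d0 : D) (Delta : structure tau D).
Hypothesis Delta_ordered : ordered (age Delta).
Hypothesis Delta_homogeneous : homogeneous Delta.
Hypothesis Delta_ramsey : ramsey (age Delta).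
Hypothesis Delta_bounded : finitely_bounded (age Delta).
Variables (sigma : signature) (Gamma : structure sigma D).
Hypothesis Gamma_reduct : reduct Gamma Delta.

Lemma reduct_automorphism g : automorphism Delta g -> isomorphism Gamma Gamma g.
Proof.
move=> gaut; split; first by case: gaut.
move=> s t; have [p defp] := Gamma_reduct s.
by rewrite !defp; exact: sat_automorphism.
Qed.

Lemma expr_decidable :
  decidable_problem (@expr_input_code sigma) (Expr_ex Gamma) /\
  decidable_problem (@expr_input_code sigma) (Expr_ep Gamma).
Proof.
have [nF [F F_bounds]] := Delta_bounded.
(* Large enough for all symbols and bounds, and for transitivity of equality. *)
pose b := (\max_(s : tau) (ar s).*2) + (\max_(s : sigma) ar s) +
  (\max_(i < nF) #|F i|) + 3.
have b_gt2 : 2 < b by rewrite /b; lia.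
have b_ar (s : tau) : (ar s).*2 <= b.
  by have := @leq_bigmax (sym tau) (fun s => (ar s).*2) s; rewrite /b; lia.
have b_sigma (s : sigma) : ar s <= b.
  by have := @leq_bigmax (sym sigma) (fun s => ar s) s; rewrite /b; lia.
have b_F i : #|F i| <= b.
  apply: leq_trans (leq_addr 3 _); apply: leq_trans (leq_addl _ _).
  exact: (@leq_bigmax 'I_nF (fun i => #|F i|)).
have inv n (p : formula sigma n) := @sem_invariant tau D d0 Delta Delta_homogeneous
  sigma Gamma reduct_automorphism n p.
have correct (x : expr_input sigma) (I : finType) (q : I -> qf_formula sigma)
    (lit : forall N i, (qf_arity (q i)).-tuple 'I_N -> formula (source_signature x) N)
    (lst : seq (nat * nat) -> seq (nat * nat)) (positive : bool) (ieq : I) :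
    (forall f, all f (lst (map (@formula_pair sigma) (sources x))) <->
       forall i, f (formula_pair (q i))) ->
    q ieq = eq_qf sigma ->
    (forall N i (a : (qf_arity (q i)).-tuple 'I_N), quantifier_free (lit N i a)) ->
    (forall N i (a : (qf_arity (q i)).-tuple 'I_N) (e : N.-tuple D),
      sat (source_structure Gamma (x := x)) (lit N i a) e <->
      sem d0 Gamma (q i) (sel d0 e (map val a))) ->
    (positive -> forall N i (a : (qf_arity (q i)).-tuple 'I_N),
      negation_free (lit N i a)) ->
    (forall N (p : formula (source_signature x) N), atomic p ->
      exists i a, p = lit N i a) ->
    (~~ positive -> forall N (p : formula (source_signature x) N), atomic p ->
      exists i a, FNot p = lit N i a) ->
    decide b (colours d0 Delta b) (act_dom d0 Delta b) (act_val d0 Delta b)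
      (eq_colours d0 Delta b) (rel_colours d0 Delta Gamma b) lst (expr_input_code
        x) <->
    exists p : formula (source_signature x) (qf_arity (target x)),
      allowed positive p /\
      defines (source_structure Gamma (x := x)) p (sat Gamma (target x)).
  move=> lstP qeq lit_qf litP lit_pos atP natP.
  rewrite /decide parse_inputE /=.
  have req : qf_arity (q ieq) = 2 by rewrite qeq.
  have Req z : sem d0 Gamma (q ieq) z <-> nth d0 z 0 = nth d0 z 1.
    by rewrite qeq; exact: sem_eq.
  have sepP := @separatedbP tau D d0 Delta Delta_ordered Delta_homogeneous
    Delta_ramsey
    sigma Gamma reduct_automorphism b b_gt2 b_ar b_sigma nF F F_bounds b_F (target x)
    I q _ lstP ieq req Req.
  have R_inv i : type_invariant d0 Delta (qf_arity (q i)) (sem d0 Gamma (q i)).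
    exact: inv.
  split=> [/negP nsep|[p [ap defp]]].
    have [p ap defp] := @not_separated_definable tau D d0 Delta Delta_homogeneous b
      b_gt2 b_ar nF F F_bounds b_F _ (source_structure Gamma (x := x)) I _ _ R_inv
      lit lit_qf litP positive lit_pos _ _ (inv _ _) (fun s => nsep (proj2 sepP s)).
    by exists p; split=> // t; rewrite -defp sem_tuple.
  apply/negP => /sepP; apply: (definable_not_separated _ _ ap) => //.
  - move=> N e e' p' ee' /atP[i [a ->]]; exact: (hom_lit litP ee').
  - move=> np N e e' p' ee' /(natP np)[i [a ea]] se'; apply: contrapT => nse.
    have : sat (source_structure Gamma (x := x)) (FNot p') e' by rewrite ea;
      apply: (hom_lit litP ee'); rewrite -ea.
    by apply.
  - by move=> t; rewrite sem_tuple.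
split.
  apply: computable_decidable (computable_decide b (colours d0 Delta b)
    (act_dom d0 Delta b) (act_val d0 Delta b) (eq_colours d0 Delta b)
    (rel_colours d0 Delta Gamma b) computable_ex_list) _ => x.
  rewrite (correct x _ (@ex_formula _ x) (@ex_lit _ x) ex_list false (true, None)) //.
  - by split=> -[p [ap defp]]; exists p; split=> //; move: ap; rewrite /allowed andbT.
  - exact: all_ex_list.
  - by move=> N [[] [i|]] a.
  - exact: sat_ex_lit.
  - by move=> N p /atomic_ep_lit[o [a ->]]; exists (true, o), a.
  - by move=> _ N p /atomic_ep_lit[o [a ->]]; exists (false, o), a.
apply: computable_decidable (computable_decide b (colours d0 Delta b)
  (act_dom d0 Delta b) (act_val d0 Delta b) (eq_colours d0 Delta b)
  (rel_colours d0 Delta Gamma b) computable_ep_list) _ => x.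
rewrite (correct x _ (@ep_formula _ x) (@ep_lit _ x) ep_list true None) //.
- exact: all_ep_list.
- by move=> N [i|] a.
- exact: sat_ep_lit.
- by move=> _ N [i|] a.
- exact: atomic_ep_lit.
Qed.
End Main.

Local Open Scope classical_set_scope.
Local Open Scope card_scope.

Theorem theorem2 (tau : signature) (D : Type) (Delta : structure tau D)
    (Dcountable : [set: D] #= [set: nat])
    (Delta_ordered : ordered (age Delta))
    (Delta_homogeneous : homogeneous Delta)
    (Delta_ramsey : ramsey (age Delta))
    (Delta_bounded : finitely_bounded (age Delta))
    (sigma : signature) (Gamma : structure sigma D)
    (Gamma_reduct : reduct Gamma Delta) :
  decidable_problem (@expr_input_code sigma) (Expr_ex Gamma) /\
  decidable_problem (@expr_input_code sigma) (Expr_ep Gamma).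
Proof.
have [d0 _] : [set: D] !=set0.
  apply/set0P/eqP => D0; move: Dcountable; rewrite D0 card_eq_sym card_eq0 => /eqP N0.
  by have : [set: nat] 0 by []; rewrite N0.
(* The points of [D] are compared in lists, hence the classical equality test. *)
exact: (@expr_decidable tau {classic D} d0 Delta Delta_ordered Delta_homogeneous
  Delta_ramsey Delta_bounded sigma Gamma Gamma_reduct).
Qed.
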